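(* Suppose that $d\in\{3,4,5\}$ and let $0<\sigma<1$ be such that $1<\frac d2-\sigma<2$. Let $g$ be a Schwartz function on $\mathbb{R}^d$. Then a solution to the Neumann problem $$\begin{cases}\partial_t^2u+\frac{1-2\sigma}{t}\partial_tu=\Delta u,\\ u(\cdot,0)=0,\quad\partial_t^\sigma u(\cdot,0)=g\end{cases}$$ is given, for $x\in\mathbb{R}^d$ and $t>0$, by $$u(x,t)=\frac{\sigma\sin\big((\frac d2-\sigma-1)\pi\big)\Gamma(\frac d2-\sigma-1)}{2\pi^{\frac d2}\sin(\sigma\pi)\Gamma(1-\sigma)}\,\frac{1}{t^2}\int_{B(x,t)}\frac{2(\sigma+1)g(y)+(y-x)\cdot\nabla g(y)}{(t^2-|x-y|^2)^{\frac d2-\sigma-1}}\,dy .$$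
   Context: $\partial_t^\sigma=\frac{1}{2\sigma}t^{1-2\sigma}\partial_t$; $\Delta$ is the Laplacian in $x\in\mathbb{R}^d$; $B(x,t)$ is the open ball with centre $x$ and radius $t$. The equation is to hold for all $x\in\mathbb{R}^d$ and $t>0$, and the initial values are understood as limits as $t\to0^+$ (for each $x$): $u(x,t)\to0$ and $\partial_t^\sigma u(x,t)\to g(x)$. *)

(* Defs.v *)
From HB Require Import structures.
From mathcomp Require Import all_boot all_order all_algebra.
From mathcomp Require Import all_classical all_reals all_analysis.
From mathcomp.real_closed Require Import complex.
Set Implicit Arguments.
Unset Strict Implicit.
Unset Printing Implicit Defensive.
Set Warnings "-redundant-canonical-projection".
Import Order.TTheory GRing.Theory Num.Theory.
Import numFieldNormedType.Exports.
Local Open Scope classical_set_scope.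
Local Open Scope ring_scope.

(* [Rcomplex R] is the library's alias of [R[i]] with [R] as field of scalars
   and the modulus as [R]-valued norm; it only lacks the topology of that
   norm. *)
Section Rcomplex_normedModType.
Variable R : realType.

HB.instance Definition _ :=
  PseudoMetric.copy (Rcomplex R) (pseudoMetric_normed (Rcomplex R)).

HB.instance Definition _ := isPointed.Build (Rcomplex R) 0.

HB.instance Definition _ :=
  NormedZmod_PseudoMetric_eq.Build R (Rcomplex R) erefl.

Lemma Rcomplex_normrZ (l : R) (z : Rcomplex R) : `|l *: z| = `|l| * `|z|.
Proof.
case: z => a b; rewrite /Num.norm/= !exprMn -mulrDr sqrtrM ?sqr_ge0//.
by rewrite sqrtr_sqr.
Qed.

HB.instance Definition _ :=
  PseudoMetricNormedZmod_Lmodule_isNormedModule.Build R (Rcomplex R)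
    Rcomplex_normrZ.

End Rcomplex_normedModType.

(* Row vectors get the sigma-algebra generated by the coordinates, as tuples
   do in the library. *)
Definition measure_rV_display : measure_display. Proof. exact. Qed.

Section measurable_rV.
Context {R : realType}.
Variable n : nat.

Let coor (i : 'I_n) (v : 'rV[R]_n) : R := v ord0 i.

Let rV_set0 : g_sigma_preimage coor set0.
Proof. exact: sigma_algebra0. Qed.

Let rV_setC A : g_sigma_preimage coor A -> g_sigma_preimage coor (~` A).
Proof. exact: sigma_algebraC. Qed.

Let rV_bigcup (F : _^nat) : (forall i, g_sigma_preimage coor (F i)) ->
  g_sigma_preimage coor (\bigcup_i (F i)).
Proof. exact: sigma_algebra_bigcup. Qed.

HB.instance Definition _ := @isMeasurable.Build measure_rV_display
  'rV[R]_n (g_sigma_preimage coor) rV_set0 rV_setC rV_bigcup.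

Lemma measurable_coor (i : 'I_n) :
  measurable_fun [set: 'rV[R]_n] (fun v : 'rV[R]_n => v ord0 i).
Proof.
move=> _ Y mY; rewrite setTI; apply: sub_sigma_algebra => /=.
rewrite -bigcup_seq/=; exists i => /=; first by rewrite mem_index_enum.
by exists Y => //; rewrite setTI.
Qed.

Lemma measurable_fun_coorP d (T : measurableType d) (f : T -> 'rV[R]_n) :
  (forall i, measurable_fun [set: T] (fun x => f x ord0 i)) ->
  measurable_fun [set: T] f.
Proof.
move=> mf _ Y mY; rewrite setTI.
have : preimage_set_system setT f measurable `<=` measurable.
  rewrite [X in X `<=` _](_ : _ = g_sigma_preimage (fun i => coor i \o f)); last first.
    by rewrite g_sigma_preimage_comp.
  apply: smallest_sub; first exact: sigma_algebra_measurable.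
  rewrite -bigcup_seq => A [i _ [B mB <-]].
  exact: mf.
by apply; exists Y => //; rewrite setTI.
Qed.

End measurable_rV.

Definition rV_cons {R : realType} {n : nat} (p : R * 'rV[R]_n) : 'rV[R]_n.+1 :=
  row_mx (\row_(_ < 1) p.1) p.2.

Definition rV_uncons {R : realType} {n : nat} (v : 'rV[R]_n.+1) : R * 'rV[R]_n :=
  (v ord0 ord0, rsubmx (v : 'rV[R]_(1 + n))).

Section lebesgue_rV_succ.
Context {R : realType} (n : nat).

Lemma rV_consK : cancel (@rV_cons R n) rV_uncons.
Proof.
move=> [a v]; rewrite /rV_uncons /rV_cons row_mxKr; congr pair => /=.
have := row_mxEl (\row_(_ < 1) a) v ord0 ord0; rewrite mxE => {2}<-.
by congr (row_mx _ _ _ _); exact: val_inj.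
Qed.

Lemma rV_cons_lift a (v : 'rV[R]_n) i :
  rV_cons (a, v) ord0 (lift ord0 i) = v ord0 i.
Proof.
have <- : rshift 1 i = lift ord0 i by apply: val_inj.
exact: (row_mxEr _ v).
Qed.

Lemma rV_unconsK : cancel (@rV_uncons R n) rV_cons.
Proof.
move=> v; rewrite /rV_uncons /rV_cons/=.
apply: etrans (hsubmxK (v : 'rV[R]_(1 + n))).
apply: (congr1 (row_mx^~ _)); apply/rowP => i; rewrite !mxE ord1.
by congr (fun_of_matrix v _ _); apply: val_inj; rewrite (ord1 i).
Qed.

Lemma measurable_rV_cons : measurable_fun [set: R * 'rV[R]_n] (@rV_cons R n).
Proof.
apply: measurable_fun_coorP => i.
have [j|j] := split_ordP (i : 'I_(1 + n)) => ->.
  rewrite (_ : (fun _ => _) = fst)//; apply/funext => p.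
  by apply: etrans (row_mxEl (\row_(_ < 1) p.1) p.2 _ _) _; rewrite mxE.
rewrite (_ : (fun _ => _) = (fun v : 'rV[R]_n => v ord0 j) \o snd).
  by apply: measurableT_comp => //; exact: measurable_coor.
by apply/funext => p; apply: etrans (row_mxEr (\row_(_ < 1) p.1) p.2 _ _) _.
Qed.

Lemma measurable_rV_uncons : measurable_fun [set: 'rV[R]_n.+1] (@rV_uncons R n).
Proof.
apply/measurable_fun_pairP; split; first exact: measurable_coor.
apply: measurable_fun_coorP => i.
rewrite (_ : (fun _ => _) = (fun v : 'rV[R]_n.+1 => v ord0 (rshift 1 i))).
  exact: measurable_coor.
by apply/funext => v /=; rewrite mxE.
Qed.

Variable mu : {sigma_finite_measure set 'rV[R]_n -> \bar R}.

Definition lebesgue_rV_succ : set 'rV[R]_n.+1 -> \bar R :=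
  pushforward (lebesgue_measure \x mu)%E (@rV_cons R n).

Let lebesgue_rV_succ0 : lebesgue_rV_succ set0 = 0%E.
Proof. by rewrite /lebesgue_rV_succ /pushforward preimage_set0 measure0. Qed.

Let lebesgue_rV_succ_ge0 A : (0 <= lebesgue_rV_succ A)%E.
Proof. by rewrite /lebesgue_rV_succ /pushforward measure_ge0. Qed.

Let lebesgue_rV_succ_semi_sigma_additive : semi_sigma_additive lebesgue_rV_succ.
Proof.
move=> F mF tF mUF; rewrite /lebesgue_rV_succ /pushforward preimage_bigcup.
apply: measure_semi_sigma_additive.
- by move=> k; rewrite -[X in measurable X]setTI; exact: measurable_rV_cons.
- apply/trivIsetP => /= i j _ _ ij; rewrite -preimage_setI.
  by move/trivIsetP : tF => /(_ _ _ _ _ ij) ->//; rewrite preimage_set0.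
- rewrite -preimage_bigcup -[X in measurable X]setTI.
  exact: measurable_rV_cons.
Qed.

HB.instance Definition _ := isMeasure.Build _ _ _ lebesgue_rV_succ
  lebesgue_rV_succ0 lebesgue_rV_succ_ge0 lebesgue_rV_succ_semi_sigma_additive.

Let lebesgue_rV_succ_sigma_finite : sigma_finite setT lebesgue_rV_succ.
Proof.
have /sigma_finiteP[F [TF ndF Foo]] := sigma_finiteT (@lebesgue_measure R).
have /sigma_finiteP[G [TG ndG Goo]] := sigma_finiteT mu.
exists (fun k => @rV_uncons R n @^-1` (F k `*` G k)).
  apply/esym; rewrite -subTset => v _.
  have [i _ Fi] : (\bigcup_i F i) (rV_uncons v).1 by rewrite -TF.
  have [j _ Gj] : (\bigcup_i G i) (rV_uncons v).2 by rewrite -TG.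
  exists (maxn i j) => //; split.
    by move: Fi; exact/subsetPset/ndF/leq_maxl.
  by move: Gj; exact/subsetPset/ndG/leq_maxr.
move=> k; have [mF Foo'] := Foo k; have [mG Goo'] := Goo k; split.
  rewrite -[X in measurable X]setTI.
  by apply: measurable_rV_uncons => //; exact: measurableX.
rewrite /lebesgue_rV_succ /pushforward -comp_preimage.
rewrite (_ : _ \o _ = id) ?preimage_id; last first.
  by apply/funext => p /=; rewrite rV_consK.
by rewrite product_measure1E// lte_mul_pinfty// ge0_fin_numE.
Qed.

HB.instance Definition _ := Measure_isSigmaFinite.Build _ _ _ lebesgue_rV_succ
  lebesgue_rV_succ_sigma_finite.

End lebesgue_rV_succ.

Fixpoint lebesgue_rV {R : realType} (n : nat) :
    {sigma_finite_measure set 'rV[R]_n -> \bar R} :=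
  if n is n'.+1 then lebesgue_rV_succ (lebesgue_rV n')
  else dirac (0 : 'rV[R]_0).

Lemma lebesgue_rV_box {R : realType} n (A : 'I_n -> set R) :
  (forall i, measurable (A i)) ->
  lebesgue_rV n [set v : 'rV[R]_n | forall i, A i (v ord0 i)] =
  (\prod_(i < n) lebesgue_measure (A i))%E.
Proof.
elim: n => [|n IH] in A * => mA.
  rewrite big_ord0 /= diracE mem_set//= => -[]//.
rewrite big_ord_recl -IH// -product_measure1E; first last.
- rewrite (_ : [set _ | _] = \bigcap_(i in [set: 'I_n])
    ((fun v : 'rV[R]_n => v ord0 i) @^-1` A (lift ord0 i))); last first.
    by apply/seteqP; split => v /= h i; [move=> _|]; exact: h.
  apply: fin_bigcap_measurable => // i _.
  by rewrite -[X in measurable X]setTI; apply: measurable_coor.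
- exact: mA.
rewrite /= /lebesgue_rV_succ /pushforward.
apply: (congr1 (lebesgue_measure \x lebesgue_rV n)%E).
apply/seteqP; split => [[a v]|[a v] [/= Aa Av] i] /=.
  move=> h; split => [|i] /=.
    by have := h ord0; rewrite (congr1 fst (rV_consK (a, v)) : _ ord0 ord0 = a).
  by have := h (lift ord0 i); rewrite rV_cons_lift.
case: (unliftP ord0 i) => [j ->|->]; first by rewrite rV_cons_lift; exact: Av.
by rewrite (congr1 fst (rV_consK (a, v)) : _ ord0 ord0 = a).
Qed.

Section functions_of_n_variables.
Context {R : realType} {d : nat}.
Implicit Types (f g : 'rV[R]_d -> Rcomplex R) (x y v : 'rV[R]_d).

(* The library's norm on ['rV[R]_d] is the sup norm. *)
Definition euclidean_norm v : R := Num.sqrt (\sum_i v ord0 i ^+ 2).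

Definition euclidean_ball x (r : R) : set 'rV[R]_d :=
  [set y | euclidean_norm (x - y) < r].

Definition basis_vector (i : 'I_d) : 'rV[R]_d := delta_mx ord0 i.

Definition partial (i : 'I_d) f : 'rV[R]_d -> Rcomplex R :=
  fun x => 'D_(basis_vector i) f x.

Definition iter_partial (s : seq 'I_d) f : 'rV[R]_d -> Rcomplex R :=
  foldr partial f s.

Definition laplacian f x : Rcomplex R := \sum_i partial i (partial i f) x.

Definition dot_gradient v f x : Rcomplex R := \sum_i v ord0 i *: partial i f x.

Definition smooth f : Prop := forall s : seq 'I_d,
  continuous (iter_partial s f) /\
  forall i x, derivable (iter_partial s f) x (basis_vector i).

Definition monomial (a : 'I_d -> nat) x : R := \prod_i x ord0 i ^+ a i.

Definition schwartz f : Prop :=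
  smooth f /\
  forall (a : 'I_d -> nat) (s : seq 'I_d), exists M : R, forall x,
    `|monomial a x *: iter_partial s f x| <= M.

End functions_of_n_variables.

Section complex_integral.
Context d (T : measurableType d) (R : realType).
Variable mu : {measure set T -> \bar R}.
Implicit Types (D : set T) (f : T -> Rcomplex R).

Definition cintegrable D f : Prop :=
  mu.-integrable D (fun x => (complex.Re (f x))%:E) /\
  mu.-integrable D (fun x => (complex.Im (f x))%:E).

Definition cintegral D f : Rcomplex R :=
  Complex (\int[mu]_(x in D) complex.Re (f x))
          (\int[mu]_(x in D) complex.Im (f x)).

End complex_integral.

(* Only meaningful for [0 < s], where the integrand is integrable. *)
Definition Gamma {R : realType} (s : R) : R :=
  \int[lebesgue_measure]_(r in `]0, +oo[) (r `^ (s - 1) * expR (- r)).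

Section neumann_problem.
Context {R : realType} {d : nat}.
Variables (sigma : R) (g : 'rV[R]_d -> Rcomplex R).
Implicit Types u : 'rV[R]_d -> R -> Rcomplex R.

Definition sigma_dt u (x : 'rV[R]_d) (t : R) : Rcomplex R :=
  ((2 * sigma)^-1 * t `^ (1 - 2 * sigma)) *: derive1 (u x) t.

(* The derivatives in the equation are required to exist, as the library's
   derivative of a non-differentiable function is a junk value. *)
Definition pde_holds u : Prop := forall (x : 'rV[R]_d) (t : R), 0 < t ->
  [/\ derivable (u x) t 1 /\ derivable (derive1 (u x)) t 1,
      forall i, derivable (u^~ t) x (basis_vector i) /\
                derivable (partial i (u^~ t)) x (basis_vector i) &
      derive1n 2 (u x) t + ((1 - 2 * sigma) / t) *: derive1 (u x) t =
      laplacian (u^~ t) x].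

Definition neumann_solution u : Prop :=
  [/\ pde_holds u,
      forall x, u x t @[t --> 0^'+] --> (0 : Rcomplex R) &
      forall x, sigma_dt u x t @[t --> 0^'+] --> g x].

End neumann_problem.

(* Main.v *)
Require Import Defs.
From mathcomp Require Import all_boot all_order all_algebra.
From mathcomp Require Import all_classical all_reals all_analysis.
From mathcomp.real_closed Require Import complex.
From mathcomp Require Import measurable_realfun ring lra.
Set Implicit Arguments.
Unset Strict Implicit.
Unset Printing Implicit Defensive.
Import Order.TTheory GRing.Theory Num.Theory.
Import numFieldNormedType.Exports.
Local Open Scope classical_set_scope.
Local Open Scope ring_scope.

(** Put [a = d/2 - sigma - 1] and [s = 2 sigma].  The substitution [y = x + t z]
    turns the integral over [B(x, t)], divided by [t^2], into
      [t^s ((s + 2) A[g] + sum_i A_i)]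
    where [A[h](x, t)] is the integral of [(1 - |z|^2)^(-a) h(x + t z)] over the
    unit ball and [A_i] is the integral of
    [(1 - |z|^2)^(-a) t z_i (partial i g)(x + t z)].  As [2 z_i (1 - a)] times
    [(1 - |z|^2)^(-a)] is minus the derivative along [z_i] of
    [(1 - |z|^2)^(1-a)], which vanishes on the unit sphere, an integration by
    parts ([ball_by_parts]) moves a second derivative onto [g]: with [W] the
    average for the exponent [1 - a], the sum of the [A_i] is
    [t^2 / (2 (1 - a)) W[Delta g]].  So the candidate solution is a constant times
      [wave = t^s ((s + 2) A[g] + t^2 / (2 (1 - a)) W[Delta g])].

    The same integration by parts, applied to the derivatives of the averages in
    [t], gives two identities: the derivative of [A[h]] is
    [t / (2 (1 - a)) W[Delta h]] ([is_derive_average_t]) and that of [W[h]] is a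
    combination of [A[h]] and [W[h]] divided by [t] ([is_derive_average_t_euler]).
    They close the system: thanks to [s + 4 = 2 (1 - a) + d], the derivative of
    [wave] is [(s / t) wave + t^(s+1) A[Delta g]] ([is_derive_wave]), and
    differentiating once more yields [wave] for the datum [Delta g] minus
    [(1 - s) / t] times the first derivative ([is_derive_wave_dt]).  Averages
    commute with the Laplacian in [x] ([rlaplacian_wave]), so this is the
    equation.  As [t] goes to [0], [wave] tends to [0] because of the factor
    [t^s], and [t^(1-s)] times its derivative, divided by [s], tends to
    [(s + 2) A[g](x, 0)], which is [g(x)] times [s + 2] times the integral of the
    weight.

    It remains to see that the constant in front normalizes this limit to [g(x)]
    ([kirchhoff_constant]).  Integrating [(r - |z|^2)^(-a) e^(-r)] over
    [|z|^2 < r] in both orders expresses the integral of the weight as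
    [pi^(d/2) Gamma(1 - a) / Gamma(sigma + 2)]
    ([ball_weight_egamma]).  The normalization then reads
      [sin(a pi) Gamma(a) Gamma(1 - a)
         = sin(sigma pi) Gamma(sigma) Gamma(1 - sigma)].
    Both sides are [pi] by Euler's reflection formula; they are shown
    below to be equal without computing either.  For [d = 4] it is the symmetry
    [tau |-> 1 - tau], as [a = 1 - sigma]; for [d = 3] and [d = 5] one also uses
    the symmetry [tau |-> 1/2 - tau] ([Gamma_half_shift]), which comes from
    deforming one beta integral into the other through a family whose parameter
    derivative is an exact differential.

    A complex datum is handled through its real and imaginary parts, all of whose
    iterated partial derivatives are continuous and bounded. *)

(** * Calculus on the line and real-valued integrals *)

Lemma is_derive_continuous {R : realType} (f : R -> R) (x df : R) :
  is_derive x 1 f df -> {for x, continuous f}.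
Proof.
by move=> [h _]; apply: differentiable_continuous; exact/derivable1_diffP.
Qed.

(** The integrands met below blow up at an end of their interval, or live on a
    half-line. The fundamental theorem on an increasing sequence of compact
    intervals exhausting the domain passes to the limit, by monotone convergence
    for a nonnegative integrand and by dominated convergence for an integrable
    one; only the limits of the primitive at the two ends are used. *)
Section FTC_exhaust.
Context {R : realType}.
Notation mu := (@lebesgue_measure R).
Variables (f F : R -> R) (D : set R) (a b : nat -> R) (l : R).
Hypothesis ab : forall n, a n < b n.
Hypothesis ndab : nondecreasing_seq (fun n => `[a n, b n]%classic : set R).
Hypothesis DE : D = \bigcup_n `[a n, b n]%classic.
Hypothesis cf : forall x, D x -> {for x, continuous f}.
Hypothesis dF : forall x, D x -> is_derive x 1 F (f x).
Hypothesis Fl : F (b n) - F (a n) @[n --> \oo] --> l.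

Let subD n : `[a n, b n] `<=` D.
Proof. by move=> x abx; rewrite DE; exists n. Qed.

Let cabf n : {within `[a n, b n], continuous f}.
Proof.
by apply: continuous_in_subspaceT => x /set_mem/subD; exact: cf.
Qed.

Let cF x : D x -> {for x, continuous F}.
Proof.
by move=> /dF; exact: is_derive_continuous.
Qed.

Let FTCn n : (\int[mu]_(x in `[a n, b n]) (f x)%:E = (F (b n) - F (a n))%:E)%E.
Proof.
rewrite EFinB; apply: continuous_FTC2 => //.
  split.
  - move=> x /subset_itv_oo_cc xab.
    by have [] := dF (subD xab).
  - apply: cvg_at_right_filter; apply: cF.
    by apply: (@subD n) => /=; rewrite in_itv/= lexx ltW.
  - apply: cvg_at_left_filter; apply: cF.
    by apply: (@subD n) => /=; rewrite in_itv/= lexx ltW.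
move=> x /subset_itv_oo_cc xab.
by have [_] := dF (subD xab); rewrite derive1E.
Qed.

Let mD : measurable D.
Proof. by rewrite DE; apply: bigcup_measurable. Qed.

Let mfn n : measurable_fun `[a n, b n] f.
Proof. exact: subspace_continuous_measurable_fun. Qed.

Lemma ge0_FTC_bigcup : (forall x, D x -> 0 <= f x) ->
  (\int[mu]_(x in D) (f x)%:E = l%:E)%E.
Proof.
move=> f0; rewrite DE.
have : (\int[mu]_(x in `[a n, b n]) (f x)%:E)%E @[n --> \oo] --> (l%:E)%E.
  by under eq_fun do rewrite FTCn; apply: cvg_EFin => //; exact: nearW.
apply: (cvg_unique _); first exact: (@ereal_hausdorff R).
apply: ge0_nondecreasing_set_cvg_integral => //.
- by move=> i; apply/measurable_EFinP; exact: mfn.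
- by move=> i x /subD Dx; rewrite lee_fin; exact: f0.
Qed.

Lemma FTC_bigcup : mu.-integrable D (EFin \o f) ->
  \int[mu]_(x in D) f x = l.
Proof.
move=> fi.
have fr n : f \_ (`[a n, b n]) = fun x => f x * \1_(`[a n, b n]) x.
  by rewrite patch_indic.
have h : (\int[mu]_(x in `[a n, b n]) (f x)%:E)%E @[n --> \oo] -->
    (\int[mu]_(x in D) (f x)%:E)%E.
  rewrite (_ : (fun n => _) = (fun n => \int[mu]_(x in D) (f \_ (`[a n, b n]) x)%:E)%E); last first.
    apply/funext => n.
    rewrite -[in LHS](setIidr (@subD n)) integral_mkcondr.
    by under eq_integral do rewrite restrict_EFin.
  apply: (@dominated_cvg _ _ _ mu _ mD _ _ (EFin \o (fun x => `|f x|))).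
  - move=> n; apply/measurable_EFinP.
    apply/(measurable_restrict f _ mD) => //.
    by rewrite (setIidr (@subD n)); exact: mfn.
  - move=> x Dx; move: (Dx); rewrite [in X in X -> _]DE => -[m _ xm].
    apply: cvg_near_cst; exists m => // n /= mn.
    rewrite patchE mem_set//.
    by have := ndab mn; rewrite subsetEset; apply.
  - by [].
  - exact: integrable_norm.
  - by move=> n x Dx; rewrite /= patchE; case: ifPn => _; rewrite ?normr0 lee_fin.
have : (\int[mu]_(x in `[a n, b n]) (f x)%:E)%E @[n --> \oo] --> (l%:E)%E.
  by under eq_fun do rewrite FTCn; apply: cvg_EFin => //; exact: nearW.
move=> /(cvg_unique (@ereal_hausdorff R) h).
by rewrite /Rintegral => ->.
Qed.

End FTC_exhaust.

Section FTC_open.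
Context {R : realType}.
Notation mu := (@lebesgue_measure R).
Implicit Types (f F : R -> R) (a b la lb : R).

Let left_seq a e (n : nat) : R := a + e / n.+3%:R.

Let left_seq_gt a e n : 0 < e -> a < left_seq a e n.
Proof. by move=> e0; rewrite /left_seq ltrDl divr_gt0. Qed.

Let left_seq_cvg a e : left_seq a e n @[n --> \oo] --> a.
Proof.
rewrite -[X in _ --> X]addr0; apply: cvgD; first exact: cvg_cst.
rewrite -(mulr0 e); apply: cvgM; first exact: cvg_cst.
have h := @cvg_harmonic R; rewrite -(cvg_shiftn 2) in h.
by apply: cvg_trans h; apply: near_eq_cvg; near=> n; rewrite /= addn2.
Unshelve. all: by end_near. Qed.

Let left_seq_ni a e : 0 < e -> nonincreasing_seq (left_seq a e).
Proof.
move=> e0 m n mn; rewrite /left_seq lerD2l ler_pM2l// lef_pV2 ?posrE//.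
by rewrite ler_nat !ltnS.
Qed.

Let right_seq b e n := left_seq b (- e) n.

Let right_seq_lt b e n : 0 < e -> right_seq b e n < b.
Proof.
by move=> e0; rewrite /right_seq /left_seq gtrDl pmulr_llt0 ?oppr_lt0.
Qed.

Let right_seq_nd b e : 0 < e -> nondecreasing_seq (right_seq b e).
Proof.
move=> e0 m n mn; rewrite /right_seq /left_seq lerD2l ler_nM2l ?oppr_lt0//.
by rewrite lef_pV2 ?posrE// ler_nat !ltnS.
Qed.

Let itv_nd (a b : nat -> R) : nonincreasing_seq a -> nondecreasing_seq b ->
  nondecreasing_seq (fun n => `[a n, b n]%classic : set R).
Proof.
move=> na nb m n mn; rewrite subsetEset; apply: subset_itv; rewrite bnd_simp.
  exact: na.
exact: nb.
Qed.

Section oo.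
Variables (f F : R -> R) (a b la lb : R).
Hypothesis ab : a < b.
Hypothesis cf : forall x, a < x < b -> {for x, continuous f}.
Hypothesis dF : forall x, a < x < b -> is_derive x 1 F (f x).
Hypothesis Fa : F x @[x --> a^'+] --> la.
Hypothesis Fb : F x @[x --> b^'-] --> lb.

Let e0 : 0 < b - a. Proof. by rewrite subr_gt0. Qed.
Let a_ := left_seq a (b - a).
Let b_ := right_seq b (b - a).

Let ab_ n : a_ n < b_ n.
Proof.
rewrite /a_ /b_ /right_seq /left_seq mulNr ltrBrDr -addrA -ltrBrDl -mulrDr.
rewrite gtr_pMr//.
have : n.+3%:R^-1 < 2^-1 :> R by rewrite ltf_pV2 ?posrE// ltr_nat.
by move: (_^-1) => q q2; rewrite [ltRHS](splitr 1) div1r ltrD.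
Qed.

Let DE : `]a, b[%classic = \bigcup_n `[a_ n, b_ n]%classic.
Proof.
apply/seteqP; split=> x /=; rewrite in_itv/=.
  move=> /andP[ax xb].
  suff [n ? ?] : exists2 n, a_ n <= x & x <= b_ n.
    by exists n => //=; rewrite in_itv/=; apply/andP.
  near \oo => n; exists n; apply/ltW; near: n.
    exact: (cvgr_lt _ (@left_seq_cvg a (b - a))).
  exact: (cvgr_gt _ (@left_seq_cvg b (- (b - a)))).
move=> [n _] /=; rewrite in_itv/= => /andP[x1 x2].
by rewrite (lt_le_trans (left_seq_gt _ _ e0) x1)// (le_lt_trans x2)// right_seq_lt.
Unshelve. all: by end_near. Qed.

Let Fl : F (b_ n) - F (a_ n) @[n --> \oo] --> lb - la.
Proof.
apply: cvgB.
  move/cvg_at_leftP : Fb; apply; split; last exact: left_seq_cvg.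
  by move=> n; exact: right_seq_lt.
move/cvg_at_rightP : Fa; apply; split; last exact: left_seq_cvg.
by move=> n; exact: left_seq_gt.
Qed.

Let nd_ab : nondecreasing_seq (fun n => `[a_ n, b_ n]%classic : set R).
Proof. by apply: itv_nd; [exact: left_seq_ni|exact: right_seq_nd]. Qed.

Lemma ge0_FTC_oo : (forall x, a < x < b -> 0 <= f x) ->
  (\int[mu]_(x in `]a, b[) (f x)%:E = (lb - la)%:E)%E.
Proof.
move=> f0; apply: (ge0_FTC_bigcup ab_ nd_ab DE _ _ Fl) => x /=;
  rewrite in_itv/=; [exact: cf|exact: f0].
Qed.

Lemma FTC_oo : mu.-integrable `]a, b[ (EFin \o f) ->
  \int[mu]_(x in `]a, b[) f x = lb - la.
Proof.
move=> fi; apply: (FTC_bigcup ab_ nd_ab DE _ _ Fl) => // x /=;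
  rewrite in_itv/=; exact: cf.
Qed.

End oo.

Section oy.
Variables (f F : R -> R) (a la lb : R).
Hypothesis cf : forall x, a < x -> {for x, continuous f}.
Hypothesis dF : forall x, a < x -> is_derive x 1 F (f x).
Hypothesis Fa : F x @[x --> a^'+] --> la.
Hypothesis Fb : F x @[x --> +oo] --> lb.

Let a_ := left_seq a 1.
Let b_ (n : nat) := a + 1 + n%:R.

Let ab_ n : a_ n < b_ n.
Proof.
rewrite /a_ /b_ /left_seq -addrA ltrD2l div1r.
by rewrite (@lt_le_trans _ _ 1)// ?invf_lt1 ?ltr1n// lerDl.
Qed.

Let b_cvg : b_ n @[n --> \oo] --> +oo.
Proof.
apply/cvgryPge => A; near=> n.
rewrite /b_ -lerBlDl; near: n; exact: nbhs_infty_ger.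
Unshelve. all: by end_near. Qed.

Let DE : `]a, +oo[%classic = \bigcup_n `[a_ n, b_ n]%classic.
Proof.
apply/seteqP; split=> x /=; rewrite in_itv/= andbT.
  move=> ax.
  suff [n ? ?] : exists2 n, a_ n <= x & x <= b_ n.
    by exists n => //=; rewrite in_itv/=; apply/andP.
  near \oo => n; exists n; last first.
    by near: n; move/cvgryPge : b_cvg; exact.
  apply/ltW; near: n.
  exact: (cvgr_lt _ (@left_seq_cvg a 1)).
by move=> [n _] /=; rewrite in_itv/= => /andP[/(lt_le_trans _)-> //]; exact: left_seq_gt.
Unshelve. all: by end_near. Qed.

Let Fl : F (b_ n) - F (a_ n) @[n --> \oo] --> lb - la.
Proof.
apply: cvgB.
  exact: (cvg_comp _ _ b_cvg Fb).
move/cvg_at_rightP : Fa; apply; split; last exact: left_seq_cvg.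
by move=> n; exact: left_seq_gt.
Qed.

Let nd_ab : nondecreasing_seq (fun n => `[a_ n, b_ n]%classic : set R).
Proof.
apply: itv_nd; first exact: left_seq_ni.
by move=> m n mn; rewrite /b_ lerD2l ler_nat.
Qed.

Let Dgt x : `]a, +oo[%classic x -> a < x.
Proof. by rewrite /= in_itv/= andbT. Qed.

Lemma ge0_FTC_oy : (forall x, a < x -> 0 <= f x) ->
  (\int[mu]_(x in `]a, +oo[) (f x)%:E = (lb - la)%:E)%E.
Proof.
move=> f0; apply: (ge0_FTC_bigcup ab_ nd_ab DE (fun x Dx => cf (Dgt Dx))
  (fun x Dx => dF (Dgt Dx)) Fl) => x /Dgt; exact: f0.
Qed.

Lemma FTC_oy : mu.-integrable `]a, +oo[ (EFin \o f) ->
  \int[mu]_(x in `]a, +oo[) f x = lb - la.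
Proof.
by move=> fi; exact: (FTC_bigcup ab_ nd_ab DE (fun x Dx => cf (Dgt Dx))
  (fun x Dx => dF (Dgt Dx)) Fl).
Qed.

End oy.

End FTC_open.

Section affine_R.
Context {R : realType}.
Notation mu := (@lebesgue_measure R).
Local Open Scope ereal_scope.

(** The image of Lebesgue measure under [x |-> c + t x], scaled by [t], has the
    right value on half-open intervals, which determines it. *)
Lemma ge0_integral_affine (c t : R) (f : R -> \bar R) : (0 < t)%R ->
  measurable_fun setT f -> (forall x, 0 <= f x) ->
  \int[mu]_x f x = t%:E * \int[mu]_x f (c + t * x)%R.
Proof.
move=> t0 mf f0.
pose phi (x : R) : measurableTypeR R := (c + t * x)%R.
have mphi : measurable_fun setT phi.
  by apply: measurable_funD => //; exact: measurable_funM.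
pose tnng : {nonneg R} := NngNum (ltW t0).
have -> : \int[mu]_x f (c + t * x)%R = \int[pushforward mu phi]_x f x.
  by rewrite ge0_integral_pushforward.
rewrite -[t%:E]/(tnng%:num%:E) -ge0_integral_mscale//.
apply: eq_measure_integral => A mA _.
apply: (@lebesgue_measure_unique _ (mscale tnng (pushforward mu phi))) => //.
move=> _ [[a b]] _ <-.
rewrite /= /mscale/= /pushforward.
have -> : phi @^-1` `]a, b] = `]((a - c) / t)%R, ((b - c) / t)%R]%classic.
  by apply/seteqP; split=> x /=; rewrite !in_itv/= ltr_pdivrMr// ler_pdivlMr// /phi; lra.
rewrite !lebesgue_measure_itv/= !lte_fin ltr_pM2r ?invr_gt0// ltrD2r.
case: ifP => _; last by rewrite mule0.
by rewrite -EFinB -EFinM; congr EFin; field; rewrite gt_eqF.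
Qed.

End affine_R.

Section derivation_rules.
Context {R : realType} {V : normedModType R}.
Implicit Types (f g : V -> R) (x v : V).

Lemma is_derive_mulr f g x v df dg : is_derive x v f df -> is_derive x v g dg ->
  is_derive x v (fun y => f y * g y) (df * g x + f x * dg).
Proof.
move=> hf hg; apply: is_derive_eq (is_deriveM hf hg) _.
by rewrite /GRing.scale/= addrC (mulrC (g x)).
Qed.

Lemma is_derive_addr f g x v df dg : is_derive x v f df -> is_derive x v g dg ->
  is_derive x v (fun y => f y + g y) (df + dg).
Proof. by move=> hf hg; exact: is_deriveD. Qed.

Lemma is_derive_mulcr c f x v df : is_derive x v f df ->
  is_derive x v (fun y => c * f y) (c * df).
Proof. by move=> hf; exact: is_deriveZ. Qed.

End derivation_rules.

Lemma powR_predE {R : realType} (p v : R) : 0 < v -> v `^ (p - 1) = v `^ p / v.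
Proof.
move=> v0; rewrite powRD; last by rewrite (gt_eqF v0) implybT.
by rewrite powR_inv1// ltW.
Qed.

Lemma is_derive_powR {R : realType} (p v : R) : 0 < v ->
  is_derive v 1 (fun v : R => v `^ p) (p * (v `^ p / v)).
Proof.
by move=> v0; apply: is_derive_eq (is_derive1_powR p v0) _; rewrite powR_predE.
Qed.

Section powR_extra.
Context {R : realType}.

Lemma continuous_powR_gt0 (p x : R) : 0 < x -> {for x, continuous (fun a : R => a `^ p)}.
Proof.
by move=> x0; exact: is_derive_continuous (is_derive1_powR p x0).
Qed.

Lemma powR_cvgy (p : R) : p < 0 -> a `^ p @[a --> +oo] --> 0.
Proof.
move=> p0; apply/cvgrPdist_lt => e e0.
have e1 : 0 < e `^ (p^-1) by rewrite powR_gt0.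
near=> x.
have x0 : 0 < x by near: x; exact: nbhs_pinfty_gt.
rewrite sub0r normrN ger0_norm ?powR_ge0//.
have -> : e = (e `^ (p^-1)) `^ p by rewrite -powRrM mulVf ?powRr1// ?ltW// lt_eqF.
have xe : e `^ (p^-1) < x by near: x; exact: nbhs_pinfty_gt.
have pV y : y `^ p = (y `^ (- p))^-1 by rewrite -powRN opprK.
rewrite !pV ltf_pV2 ?posrE ?powR_gt0//.
by rewrite gt0_ltr_powR ?oppr_gt0// nnegrE ?ltW ?powR_gt0.
Unshelve. all: by end_near. Qed.

(** For [p < 1] the integrand is unbounded at [0], but its primitive [x^p / p]
    has the limit [0] there. *)
Lemma integral_powR (p r : R) : 0 < p -> 0 < r ->
  (\int[lebesgue_measure]_(x in `]0%R, r[) (x `^ (p - 1))%:E = (r `^ p / p)%:E)%E.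
Proof.
move=> p0 r0.
rewrite -[X in (X)%:E]subr0.
apply: (@ge0_FTC_oo R _ (fun x => x `^ p / p)) => //.
- by move=> x /andP[x0 _]; exact: continuous_powR_gt0.
- move=> x /andP[x0 _]; have := is_derive1_powR p x0.
  move=> h; apply: (is_derive_eq (is_deriveM h (is_derive_cst p^-1 x 1))).
  by rewrite scaler0 add0r /GRing.scale/= mulrA mulVf ?mul1r// gt_eqF.
- rewrite -[X in _ --> X](mul0r p^-1); apply: cvgMl; exact: powR_cvg0.
- apply: cvgMl; apply: cvg_at_left_filter; exact: continuous_powR_gt0.
- by move=> x _; exact: powR_ge0.
Qed.

End powR_extra.

Section integral_if.
Local Open Scope ereal_scope.
Context d (T : measurableType d) (R : realType).
Variable mu : {measure set T -> \bar R}.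

(** As a test in the integrand, a domain may depend on the outer variable of an
    iterated integral, so that Tonelli's theorem applies. *)
Lemma integral_if (D : set T) (P : T -> bool) (f : T -> \bar R) :
  (forall x, D x <-> P x) ->
  \int[mu]_(x in D) f x = \int[mu]_x (if P x then f x else 0).
Proof.
move=> DP; rewrite integral_mkcond; apply: eq_integral => x _; rewrite patchE.
case: ifPn => [/set_mem/DP->//|]; case: ifPn => // /DP Dx.
by rewrite notin_setE.
Qed.

End integral_if.

Lemma measurable_inv {R : realType} : measurable_fun [set: R] (fun x : R => x^-1).
Proof.
rewrite -(setUv [set 0]); apply/measurable_funU => //.
  exact: measurableC.
split.
  exact: measurable_fun_set1.
apply: open_continuous_measurable_fun.
  rewrite openC; apply: accessible_finite_set_closed.1 => //.
  exact/hausdorff_accessible/Rhausdorff.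
by move=> x /set_mem/= /eqP x0; exact: inv_continuous.
Qed.

Section integrable_real.
Context d (T : measurableType d) (R : realType).
Variables (mu : {measure set T -> \bar R}) (D : set T).
Hypothesis mD : measurable D.
Implicit Types f g : T -> R.

Lemma Rintegrable_eq f g : (forall x, D x -> f x = g x) ->
  mu.-integrable D (EFin \o f) -> mu.-integrable D (EFin \o g).
Proof. by move=> fg; apply: eq_integrable => // x /set_mem/fg /= ->. Qed.

Lemma RintegrableZ k f : mu.-integrable D (EFin \o f) ->
  mu.-integrable D (EFin \o (fun x => k * f x)).
Proof.
move=> fi; have := integrableZl mD k fi.
by apply: eq_integrable => // x _; rewrite /= EFinM.
Qed.

Lemma RintegrableD f g : mu.-integrable D (EFin \o f) ->
  mu.-integrable D (EFin \o g) ->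
  mu.-integrable D (EFin \o (fun x => f x + g x)).
Proof.
move=> fi gi; have := integrableD mD fi gi.
by apply: eq_integrable.
Qed.

Lemma Rintegrable_sum (I : Type) (s : seq I) (f : I -> T -> R) :
  (forall i, mu.-integrable D (EFin \o f i)) ->
  mu.-integrable D (EFin \o (fun x => \sum_(i <- s) f i x)).
Proof.
move=> fi; elim: s => [|i s ih].
  apply: (Rintegrable_eq (f := fun=> 0)); last exact: integrable0.
  by move=> x _; rewrite big_nil.
apply: (Rintegrable_eq (f := fun x => f i x + \sum_(i <- s) f i x)).
  by move=> x _; rewrite big_cons.
exact: RintegrableD.
Qed.

Lemma Rintegral_sum (I : Type) (s : seq I) (f : I -> T -> R) :
  (forall i, mu.-integrable D (EFin \o f i)) ->
  \int[mu]_(x in D) (\sum_(i <- s) f i x) = \sum_(i <- s) \int[mu]_(x in D) f i x.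
Proof.
move=> fi; elim: s => [|i s ih].
  rewrite big_nil; under eq_Rintegral do rewrite big_nil.
  by rewrite /Rintegral integral0.
rewrite big_cons -ih -RintegralD//; last exact: Rintegrable_sum.
by apply: eq_Rintegral => x _; rewrite big_cons.
Qed.

End integrable_real.

Section derive_line.
Context {R : realType} {V W : normedModType R}.
Implicit Types (f : V -> W) (z v : V).

Let quotient_line f z v (s : R) :
  (fun h : R => h^-1 *: (((fun r : R => f (z + r *: v)) \o shift s) (h *: (1 : R)) - f (z + s *: v))) =
  (fun h : R => h^-1 *: ((f \o shift (z + s *: v)) (h *: v) - f (z + s *: v))).
Proof.
apply/funext => h /=; congr (_ *: (f _ - _)).
by rewrite [h *: 1]mulr1 scalerDl addrCA.
Qed.

(** A directional derivative is a derivative in one variable, to which the mean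
    value theorem and differentiation under the integral sign apply. *)
Lemma derivable_line f z v (s : R) :
  derivable (fun r : R => f (z + r *: v)) s 1 = derivable f (z + s *: v) v.
Proof. by rewrite /derivable quotient_line. Qed.

Lemma derive_line f z v (s : R) :
  'D_1 (fun r : R => f (z + r *: v)) s = 'D_v f (z + s *: v).
Proof. by rewrite /derive quotient_line. Qed.

Lemma is_derive_line f z v (s : R) df : is_derive (z + s *: v) v f df ->
  is_derive s 1 (fun r : R => f (z + r *: v)) df.
Proof. by move=> [d1 d2]; apply: DeriveDef; rewrite ?derivable_line ?derive_line. Qed.

End derive_line.

Lemma continuousMf {R : realType} {T : topologicalType} (f g : T -> R) (x : T) :
  {for x, continuous f} -> {for x, continuous g} ->
  {for x, continuous (fun y => f y * g y)}.
Proof. exact: continuousM. Qed.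

Lemma continuousDf {R : realType} {T : topologicalType} (f g : T -> R) (x : T) :
  {for x, continuous f} -> {for x, continuous g} ->
  {for x, continuous (fun y => f y + g y)}.
Proof. exact: continuousD. Qed.

Lemma continuous_mulr {R : realType} {T : topologicalType} (f g : T -> R) :
  continuous f -> continuous g -> continuous (fun y => f y * g y).
Proof. by move=> cf cg x; exact: (continuousMf (cf x) (cg x)). Qed.

Lemma continuous_addr {R : realType} {T : topologicalType} (f g : T -> R) :
  continuous f -> continuous g -> continuous (fun y => f y + g y).
Proof. by move=> cf cg x; exact: (continuousDf (cf x) (cg x)). Qed.

(** * The Gamma function and its beta integral *)

Section gamma.
Context {R : realType}.
Notation mu := (@lebesgue_measure R).
Implicit Types (s q r : R).

Lemma ge0_integral_expR (k a : R) : 0 < k ->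
  (\int[mu]_(r in `]a, +oo[) (expR (- (k * r)))%:E = (expR (- (k * a)) / k)%:E)%E.
Proof.
move=> k0.
have dl (x : R) : is_derive x 1 (fun r : R => - (k * r)) (- k).
  have h : is_derive x 1 (k \*: @id R) k.
    by apply: is_derive_eq (is_deriveZ k (is_derive_id x 1)) _; rewrite /GRing.scale/= mulr1.
  by apply: is_deriveN.
have de (x : R) : is_derive x 1 (fun r : R => expR (- (k * r))) (- k * expR (- (k * x))).
  by apply: is_derive_eq (is_derive1_comp (is_derive_expR _) (dl x)) _; rewrite mulrC.
have ce (x : R) : {for x, continuous (fun r : R => expR (- (k * r)))}.
  exact: is_derive_continuous (de x).
rewrite (_ : _ / k = 0 - - (expR (- (k * a)) / k)); last by rewrite sub0r opprK.
apply: (@ge0_FTC_oy R _ (fun r => - (expR (- (k * r)) / k))).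
- by move=> x _; exact: ce.
- move=> x _.
  apply: is_derive_eq (is_deriveN (is_deriveM (de x) (is_derive_cst k^-1 x 1))) _.
  by rewrite scaler0 add0r /GRing.scale/= mulNr mulrN opprK mulKf// gt_eqF.
- by apply: cvgN; apply: cvgMl; apply: cvg_at_right_filter; exact: ce.
- rewrite -[X in _ --> X]oppr0; apply: cvgN.
  rewrite -[X in _ --> X](mul0r k^-1); apply: cvgMl.
  apply: (cvg_comp _ _ _ (@cvgr_expR R)).
  apply/cvgryPge => A; near=> x.
  by rewrite mulrC -ler_pdivrMr//; near: x; exact: nbhs_pinfty_ge.
- by move=> x _; exact: expR_ge0.
Unshelve. all: by end_near. Qed.

(** Gamma as an extended real: Tonelli's theorem applies to it before its
    integral is known to be finite. *)
Definition egamma s : \bar R :=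
  (\int[mu]_r (if (0 < r)%R then (r `^ (s - 1) * expR (- r))%:E else 0))%E.

Lemma measurable_fun_gamma s :
  measurable_fun setT (fun r : R => (if (0 < r)%R then (r `^ (s - 1) * expR (- r))%:E else 0)%E).
Proof.
apply: measurable_fun_if => //.
- exact: measurable_fun_ltr.
- apply: measurable_funTS; apply/measurable_EFinP.
  apply: measurable_funM; first exact: measurable_powR.
  by apply: measurableT_comp => //; exact: measurableT_comp.
Qed.

Lemma egamma_ge0 s : (0 <= egamma s)%E.
Proof.
apply: integral_ge0 => r _; case: ifP => // _.
by rewrite lee_fin mulr_ge0 ?powR_ge0 ?expR_ge0.
Qed.

Lemma egammaE s :
  egamma s = (\int[mu]_(r in `]0%R, +oo[) (r `^ (s - 1) * expR (- r))%:E)%E.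
Proof. by rewrite (@integral_if _ _ _ mu _ (fun r : R => 0 < r))// => x/=; rewrite in_itv/= andbT. Qed.

Lemma egamma1 : egamma 1 = 1%E.
Proof.
rewrite egammaE.
transitivity (\int[mu]_(r in `]0%R, +oo[) (expR (- (1 * r)))%:E)%E.
  by apply: eq_integral => r _; rewrite subrr powRr0 !mul1r.
by rewrite ge0_integral_expR// mulr0 oppr0 expR0 divr1.
Qed.

Let rec_kernel s (p : R * R) : \bar R :=
  (if ((0 < p.1) && (p.1 < p.2))%R then (p.1 `^ (s - 1) * expR (- p.2))%:E else 0)%E.

Let mrec s : measurable_fun setT (rec_kernel s).
Proof.
apply: measurable_fun_if => //.
- by apply: measurable_and; apply: measurable_fun_ltr.
- apply: measurable_funTS; apply/measurable_EFinP.
  apply: measurable_funM; first exact: measurableT_comp (measurable_powR _) measurable_fst.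
  by do 2 apply: measurableT_comp => //.
Qed.

Let rec_ge0 s p : (0 <= rec_kernel s p)%E.
Proof. by rewrite /rec_kernel; case: ifP => // _; rewrite lee_fin mulr_ge0 ?powR_ge0 ?expR_ge0. Qed.

(** Write [q^(s-1) e^(-q)] as the integral of [q^(s-1) e^(-r)] over [r > q]; in
    the other order the integral over [q < r] is [r^s e^(-r) / s]. *)
Lemma egammaS s : 0 < s -> egamma (s + 1) = (s%:E * egamma s)%E.
Proof.
move=> s0.
have -> : (egamma s = \int[mu]_q \int[mu]_r rec_kernel s (q, r))%E.
  apply: eq_integral => q _; rewrite /rec_kernel/=.
  case: ifPn => q0 /=; last by rewrite integral0.
  transitivity (\int[mu]_(r in `]q, +oo[) ((q `^ (s - 1))%:E * (expR (- (1 * r)))%:E))%E.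
    rewrite ge0_integralZl_EFin ?powR_ge0//.
    + by rewrite ge0_integral_expR// divr1 mul1r EFinM.
    + apply: measurable_funTS; apply/measurable_EFinP.
      by do 2 apply: measurableT_comp => //; exact: measurable_funM.
  rewrite (@integral_if _ _ _ mu _ (fun r : R => q < r)); last by move=> x /=; rewrite in_itv/= andbT.
  by apply: eq_integral => r _; rewrite mul1r EFinM.
rewrite (@fubini_tonelli _ _ _ _ _ mu mu _ (mrec s) (rec_ge0 s)).
rewrite -ge0_integralZl_EFin ?ltW//; last 2 first.
- by move=> r _; apply: integral_ge0.
- exact: (@measurable_fun_fubini_tonelli_G _ _ _ _ _ mu _ (mrec s) (rec_ge0 s)).
apply: eq_integral => r _; rewrite /rec_kernel/=.
have [r0|r0] := ltP 0 r; last first.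
  under eq_integral do rewrite andbC.
  rewrite integral0_eq ?mule0// => q _.
  by case: ifP => // /andP[/lt_le_trans/(_ r0) /ltW/le_lt_trans h /h]; rewrite ltxx.
transitivity (s%:E * \int[mu]_(q in `]0%R, r[) ((expR (- r))%:E * (q `^ (s - 1))%:E))%E.
  rewrite ge0_integralZl_EFin ?expR_ge0//.
  - rewrite integral_powR// -!EFinM; congr EFin.
    by rewrite addrK; field; rewrite gt_eqF.
  - by move=> q _; rewrite lee_fin powR_ge0.
  - by apply: measurable_funTS; apply/measurable_EFinP; exact: measurable_powR.
congr (_ * _)%E.
rewrite (@integral_if _ _ _ mu _ (fun q : R => 0 < q < r)); last by move=> x /=; rewrite in_itv/=.
by apply: eq_integral => q _; rewrite -EFinM mulrC.
Qed.

Lemma egamma_nat_fin n : (egamma n.+1%:R < +oo)%E.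
Proof.
elim: n => [|n ih]; first by rewrite egamma1 ltry.
by rewrite -natr1 egammaS// lte_mul_pinfty.
Qed.

(** By the recurrence, the values at positive integers are finite, and it is
    enough to bound the integral at [s + 1]; there [r^s] is at most [1 + r^n]
    for an integer [n > s]. *)
Lemma egamma_fin s : 0 < s -> egamma s \is a fin_num.
Proof.
move=> s0; rewrite ge0_fin_numE ?egamma_ge0//.
suff h1 : (egamma (s + 1) < +oo)%E.
  move: h1; rewrite egammaS//.
  case: (egamma s) (egamma_ge0 s) => [r _ _|_|//]; first by rewrite ltry.
  by rewrite gt0_muley ?lte_fin.
have [n sn] : exists n : nat, s < n%:R by exists (Num.truncn s).+1; rewrite truncnS_gt.
apply: (@le_lt_trans _ _ (egamma 1 + egamma n.+1%:R)%E); last first.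
  by apply: lte_add_pinfty; [rewrite egamma1 ltry|exact: egamma_nat_fin].
rewrite /egamma -ge0_integralD//; first last.
- exact: measurable_fun_gamma.
- by move=> r _; case: ifP => // _; rewrite lee_fin mulr_ge0 ?powR_ge0 ?expR_ge0.
- exact: measurable_fun_gamma.
- by move=> r _; case: ifP => // _; rewrite lee_fin mulr_ge0 ?powR_ge0 ?expR_ge0.
apply: ge0_le_integral => //.
- by move=> r _; case: ifP => // _; rewrite lee_fin mulr_ge0 ?powR_ge0 ?expR_ge0.
- exact: measurable_fun_gamma.
- by apply: emeasurable_funD; exact: measurable_fun_gamma.
move=> r _; case: ifPn => r0; last by rewrite adde0.
rewrite -EFinD lee_fin -mulrDl ler_wpM2r ?expR_ge0// addrK subrr powRr0.
rewrite -natr1 addrK.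
have [r1|r1] := leP r 1.
  (* [r^s] is at most [1] for [r <= 1] and at most [r^n] for [r > 1]. *)
  rewrite (le_trans (_ : _ <= 1)) ?lerDl ?powR_ge0//.
  have <- : 1 `^ s = 1 :> R by rewrite powR1.
  by rewrite ge0_ler_powR// ?nnegrE// ltW.
rewrite (le_trans (_ : _ <= r `^ n%:R)) ?lerDr//.
by rewrite ler_powR// ltW.
Qed.

Lemma GammaE s : 0 < s -> egamma s = (Gamma s)%:E.
Proof. by move=> s0; rewrite /Gamma /Rintegral -egammaE fineK// egamma_fin. Qed.

Lemma Gamma_gt0 s : 0 < s -> 0 < Gamma s.
Proof.
move=> s0; rewrite -lte_fin -GammaE// egammaE.
(* For [1 < r < 2], [r^(s-1) >= r^-1 >= 1/2] because [s > 0], and [e^(-r) >=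
   e^-2]. *)
apply: (@lt_le_trans _ _ (2^-1 * expR (- 2))%:E).
  by rewrite lte_fin mulr_gt0 ?expR_gt0.
apply: (@le_trans _ _ (\int[mu]_(r in `]1%R, 2%R[) (r `^ (s - 1) * expR (- r))%:E)%E).
  rewrite [leLHS](_ : _ = (\int[mu]_(r in `]1%R, 2%R[) (2^-1 * expR (- 2))%:E)%E).
    apply: ge0_le_integral => //.
    - apply: measurable_funTS; apply/measurable_EFinP.
      apply: measurable_funM; first exact: measurable_powR.
      by apply: measurableT_comp => //; exact: measurableT_comp.
    - move=> r /=; rewrite in_itv/= => /andP[r1 r2].
      rewrite lee_fin ler_pM ?expR_ge0//; last by rewrite ler_expR lerN2 ltW.
      apply: (@le_trans _ _ (r `^ (-1))).
        by rewrite powR_inv1 ?lef_pV2 ?posrE ?ltW//; apply: lt_trans r1.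
      by rewrite ler_powR ?ltW//; lra.
  rewrite integral_cst//= lebesgue_measure_itv/= lte_fin ltr1n -EFinB.
  by rewrite (_ : 2 - 1 = 1) ?mule1//; lra.
apply: ge0_subset_integral => //.
- apply: measurable_funTS; apply/measurable_EFinP.
  apply: measurable_funM; first exact: measurable_powR.
  by apply: measurableT_comp => //; exact: measurableT_comp.
- by move=> r _; rewrite lee_fin mulr_ge0 ?powR_ge0 ?expR_ge0.
- by move=> r /=; rewrite !in_itv/= => /andP[r1 _]; rewrite andbT (lt_trans _ r1).
Qed.

Lemma GammaS s : 0 < s -> Gamma (s + 1) = s * Gamma s.
Proof.
move=> s0; apply: EFin_inj; rewrite EFinM -!GammaE ?addr_gt0//; exact: egammaS.
Qed.

Let refl_kernel q (p : R * R) : \bar R :=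
  (if ((0 < p.1) && (0 < p.2))%R then (p.2 `^ (q - 1) * expR (- ((1 + p.2) * p.1)))%:E else 0)%E.

Let mrefl q : measurable_fun setT (refl_kernel q).
Proof.
apply: measurable_fun_if => //.
- by apply: measurable_and; apply: measurable_fun_ltr.
- apply: measurable_funTS; apply/measurable_EFinP.
  apply: measurable_funM; first exact: measurableT_comp (measurable_powR _) measurable_snd.
  do 2 apply: measurableT_comp => //.
  by apply: measurable_funM => //; exact: measurable_funD.
Qed.

Let refl_ge0 q p : (0 <= refl_kernel q p)%E.
Proof. by rewrite /refl_kernel; case: ifP => // _; rewrite lee_fin mulr_ge0 ?powR_ge0 ?expR_ge0. Qed.

(** Substituting [r v] for the inner variable, [r] being the outer one, leaves
    [e^(-(1 + v) r)] to integrate in [r]. *)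
Lemma egamma_refl q : 0 < q < 1 -> (egamma q * egamma (1 - q) =
  \int[mu]_(v in `]0%R, +oo[) (v `^ (q - 1) / (1 + v))%:E)%E.
Proof.
move=> /andP[q0 q1].
rewrite -(fineK (egamma_fin q0)) -ge0_integralZl_EFin//; first last.
- exact: fine_ge0 (egamma_ge0 q).
- exact: measurable_fun_gamma.
- by move=> r _; case: ifP => // _; rewrite lee_fin mulr_ge0 ?powR_ge0 ?expR_ge0.
rewrite fineK ?egamma_fin//.
transitivity (\int[mu]_r \int[mu]_v refl_kernel q (r, v))%E.
  apply: eq_integral => r _; rewrite /refl_kernel/=.
  case: ifPn => r0 /=; last by rewrite mule0 integral0.
  rewrite /egamma (@ge0_integral_affine _ 0 r)//; first last.
  - by move=> x; case: ifP => // _; rewrite lee_fin mulr_ge0 ?powR_ge0 ?expR_ge0.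
  - exact: measurable_fun_gamma.
  rewrite muleAC -EFinM -ge0_integralZl_EFin//; first last.
  - by rewrite !mulr_ge0 ?powR_ge0 ?expR_ge0// ltW.
  - apply: (measurableT_comp (measurable_fun_gamma _)) => //.
    by apply: measurable_funD => //; exact: measurable_funM.
  - by move=> v _; case: ifP => // _; rewrite lee_fin mulr_ge0 ?powR_ge0 ?expR_ge0.
  apply: eq_integral => v _; rewrite add0r pmulr_rgt0//.
  case: ifPn => v0; last by rewrite mule0.
  rewrite -EFinM; congr EFin.
  rewrite powRM ?ltW// mulrDl mul1r opprD expRD (mulrC v r).
  transitivity ((r * r `^ (1 - q - 1) * r `^ (q - 1)) * (v `^ (q - 1) * (expR (- r) * expR (- (r * v))))); first by ring.
  rewrite -[X in X * r `^ (1 - q - 1)](powRr1 (ltW r0)) -!powRD ?(gt_eqF r0) ?implybT//.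
  have -> : 1 + (1 - q - 1) + (q - 1) = 0 by lra.
  by rewrite powRr0 mul1r.
rewrite (@fubini_tonelli _ _ _ _ _ mu mu _ (mrefl q) (refl_ge0 q)).
rewrite [RHS](@integral_if _ _ _ mu _ (fun r : R => 0 < r)); last by move=> x /=; rewrite in_itv/= andbT.
apply: eq_integral => v _; rewrite /refl_kernel/=.
case: ifPn => v0; last first.
  by under eq_integral do rewrite andbF; rewrite integral0.
have v1 : 0 < 1 + v by rewrite addr_gt0.
transitivity (\int[mu]_(r in `]0%R, +oo[) ((v `^ (q - 1))%:E * (expR (- ((1 + v) * r)))%:E))%E.
  rewrite [RHS](@integral_if _ _ _ mu _ (fun r : R => 0 < r)); last by move=> x /=; rewrite in_itv/= andbT.
  by apply: eq_integral => r _; rewrite andbT EFinM.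
rewrite ge0_integralZl_EFin ?powR_ge0//.
  by rewrite ge0_integral_expR// mulr0 oppr0 expR0 div1r EFinM.
apply: measurable_funTS; apply/measurable_EFinP.
by do 2 apply: measurableT_comp => //; exact: measurable_funM.
Qed.

Lemma integrable_beta_kernel q : 0 < q < 1 ->
  mu.-integrable `]0%R, +oo[ (EFin \o (fun v : R => v `^ (q - 1) / (1 + v))).
Proof.
move=> q01; apply/integrableP; split.
  apply: measurable_funTS; apply/measurable_EFinP.
  apply: measurable_funM; first exact: measurable_powR.
  by apply: (measurableT_comp measurable_inv); exact: measurable_funD.
under eq_integral => v.
  rewrite inE/= in_itv/= andbT => v0.
  rewrite /= ger0_norm; last by rewrite divr_ge0 ?powR_ge0// addr_ge0// ltW.
  over.
have /andP[q0 q1] := q01.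
by rewrite -egamma_refl// ltey_eq fin_numM// egamma_fin// subr_gt0.
Qed.

Lemma Gamma_refl q : 0 < q < 1 ->
  Gamma q * Gamma (1 - q) = \int[mu]_(v in `]0%R, +oo[) (v `^ (q - 1) / (1 + v)).
Proof.
move=> q01; have /andP[q0 q1] := q01.
by apply: EFin_inj; rewrite EFinM -!GammaE ?subr_gt0// egamma_refl// /Rintegral fineK//
  integrable_fin_num//; exact: integrable_beta_kernel.
Qed.

End gamma.

(** * The symmetry of sin(tau pi) Gamma(tau) Gamma(1 - tau) under tau |-> 1/2 - tau *)

(** Beyond [pi / 2] this is [sin y <= y]. It keeps the denominators of the
    deformation below away from [0] for angles in a neighbourhood of the first
    quadrant. *)
Lemma cos_ge_Nhalf {R : realType} (x : R) : - 2^-1 <= x -> x <= pi / 2 + 2^-1 -> - 2^-1 <= cos x.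
Proof.
have pi2 : 1 <= pi / 2 :> R by have := pi_ge2 R; lra.
move=> x1 x2; have [xp|xp] := leP x (pi / 2).
  suff : 0 <= cos x by lra.
  by apply: cos_ge0_pihalf; apply/andP; split => //; lra.
have e : cos x = - sin (x - pi / 2) by rewrite -cosDpihalf subrK.
rewrite e lerN2.
suff h (y : R) : 0 < y -> sin y <= y by apply: le_trans (h _ _) _; lra.
move=> y0.
have [c _] := @MVT R sin cos 0 y y0 (fun x _ => is_derive_sin x)
  (continuous_subspaceT (@continuous_sin R)).
rewrite sin0 !subr0 => ->; rewrite ger_pMl//; exact: cos_le1.
Qed.

Section half_shift.
Context {R : realType}.
Notation mu := (@lebesgue_measure R).
Variable tau : R.
Hypothesis tau0 : 0 < tau.
Hypothesis tau2 : tau < 2^-1.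

Let rt (v : R) := v `^ 2^-1.
Let Dn (th v : R) := 1 + 2 * cos th * rt v + v.
Let A (th : R) := cos (2 * tau * th).
Let B (th : R) := cos ((1 - 2 * tau) * th).
Let S (th : R) := sin (2 * tau * th).
Let S' (th : R) := sin ((1 - 2 * tau) * th).
(** A deformation of the difference of two beta integrals: at [th = pi / 2] the
    denominator is [1 + v], and [dkernel], the derivative in [th], is the
    derivative in [v] of [flux]. *)
Let kernel (th v : R) := v `^ (tau - 1) * ((rt v * S' th - S th) * (Dn th v)^-1).
Let dkernel (th v : R) := v `^ (tau - 1) *
  ((rt v * ((1 - 2 * tau) * B th) - 2 * tau * A th) * (Dn th v)^-1 +
   (rt v * S' th - S th) * (2 * sin th * rt v) * (Dn th v)^-2).
Let flux (th v : R) := - 2 * (v `^ tau * ((A th + rt v * B th) * (Dn th v)^-1)).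
(** An open neighbourhood of the closed interval from [0] to [pi / 2], on which
    [cos th >= - 1/2], whence [(1 + v) / 2 <= Dn th v]. *)
Let I : set R := `](- 2^-1), (pi / 2 + 2^-1)[.

Let A_E th : A th = cos th * B th + sin th * S' th.
Proof. by rewrite /A /B /S' -cosB; congr cos; ring. Qed.

Let B_E th : B th = cos th * A th + sin th * S th.
Proof. by rewrite /A /B /S -cosB; congr cos; ring. Qed.

Let rt_gt0 (v : R) : 0 < v -> 0 < rt v. Proof. exact: powR_gt0. Qed.

Let rt_sqr (v : R) : 0 < v -> rt v * rt v = v.
Proof.
move=> v0; rewrite -powRD; last by rewrite (gt_eqF v0) implybT.
have -> : 2^-1 + 2^-1 = 1 :> R by lra.
by rewrite powRr1// ltW.
Qed.

Let Dn_ge (th v : R) : I th -> 0 < v -> (1 + v) / 2 <= Dn th v.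
Proof.
rewrite /I/= in_itv/= => /andP[/ltW t1 /ltW t2] v0.
have c := cos_ge_Nhalf t1 t2; have r0 := rt_gt0 v0.
have h : rt v <= (1 + v) / 2.
  by have := sqr_ge0 (1 - rt v); rewrite -[in (1 + v)](rt_sqr v0); nra.
rewrite /Dn; nra.
Qed.

Let Dn_gt0 (th v : R) : I th -> 0 < v -> 0 < Dn th v.
Proof. by move=> Ith v0; apply: lt_le_trans (Dn_ge Ith v0); rewrite divr_gt0// addr_gt0. Qed.

Let d_lin (c : R) (x : R) : is_derive x 1 (fun t : R => c * t) c.
Proof.
by apply: is_derive_eq (is_deriveZ c (is_derive_id x 1)) _; rewrite /GRing.scale/= mulr1.
Qed.

Let d_sin (c : R) (x : R) : is_derive x 1 (fun t : R => sin (c * t)) (c * cos (c * x)).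
Proof. by apply: is_derive_eq (is_derive1_comp (is_derive_sin _) (d_lin c x)) _; rewrite mulrC. Qed.

Let d_kernel (th v : R) : I th -> 0 < v -> is_derive th 1 (kernel^~ v) (dkernel th v).
Proof.
move=> Ith v0; have D0 := Dn_gt0 Ith v0.
have dD : is_derive th 1 (Dn^~ v) (- (2 * sin th * rt v)).
  have h1 := is_derive_addr (is_derive_cst (1 : R) th 1) (is_derive_mulcr (2 * rt v) (is_derive_cos th)).
  have h2 := is_derive_addr h1 (is_derive_cst v th 1).
  rewrite (_ : Dn^~ v = (fun t => cst 1 t + 2 * rt v * cos t + cst v t)); last first.
    by apply/funext => t; rewrite /Dn/=; ring.
  by apply: is_derive_eq h2 _; ring.
have dN : is_derive th 1 (fun th => rt v * S' th - S th)
    (rt v * ((1 - 2 * tau) * B th) - 2 * tau * A th).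
  have h := is_derive_addr (is_derive_mulcr (rt v) (d_sin (1 - 2 * tau) th)) (is_deriveN (d_sin (2 * tau) th)).
  exact: h.
have D1 : Dn th v != 0 by rewrite gt_eqF.
have h : is_derive th 1 (kernel^~ v) _ := is_derive_mulcr (v `^ (tau - 1)) (is_derive_mulr dN (@is_deriveV R (Dn^~ v) _ _ _ D1 dD)).
apply: (is_derive_eq h).
rewrite /dkernel /GRing.scale/=; congr (_ * (_ + _)).
by rewrite mulrNN; ring.
Qed.

Let d_flux (th v : R) : I th -> 0 < v -> is_derive v 1 (flux th) (dkernel th v).
Proof.
move=> Ith v0; have D0 := Dn_gt0 Ith v0.
have D1 : Dn th v != 0 by rewrite gt_eqF.
have drt : is_derive v 1 rt (2^-1 * (rt v / v)) by exact: is_derive_powR.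
have dD : is_derive v 1 (Dn th) (2 * cos th * (2^-1 * (rt v / v)) + 1).
  have := is_derive_addr (is_derive_addr (is_derive_cst (1 : R) v 1) (is_derive_mulcr (2 * cos th) drt)) (is_derive_id v 1).
  by rewrite add0r.
have dN : is_derive v 1 (fun v => A th + rt v * B th) (2^-1 * (rt v / v) * B th).
  have := is_derive_addr (is_derive_cst (A th) v 1) (is_derive_mulr drt (is_derive_cst (B th) v 1)).
  by rewrite add0r mulr0 addr0.
have dV := is_deriveV D1 dD.
apply: is_derive_eq (is_derive_mulcr (-2) (is_derive_mulr (is_derive_powR tau v0) (is_derive_mulr dN dV))) _.
rewrite /dkernel /GRing.scale/=.
rewrite powR_predE//.
move: D1; rewrite /Dn; have r0 := rt_gt0 v0; move: r0 (rt_sqr v0).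
have Eq1 := A_E th; have Eq2 := B_E th.
move: (A th) (B th) (S th) (S' th) (cos th) (sin th) Eq1 Eq2 => a b s s' c sn Eq1 Eq2.
move: (rt v) (v `^ tau) => x w x0 <- D1.
have x1 : x != 0 by rewrite gt_eqF.
(* After clearing denominators, the two sides differ by a multiple of this
   combination, which vanishes by the addition formulas [A_E] and [B_E]. *)
have key : x * (a - b * c - sn * s') + (a * c - b + sn * s) = 0.
  have e1 : a - b * c - sn * s' = 0 by rewrite {1}Eq1; ring.
  have e2 : a * c - b + sn * s = 0 by rewrite {1}Eq2; ring.
  by rewrite e1 e2 mulr0 addr0.
apply/eqP; rewrite -subr_eq0; apply/eqP.
rewrite [LHS](_ : _ = 2 * w / x * (x * (a - b * c - sn * s') + (a * c - b + sn * s)) * (1 + 2 * c * x + x * x) ^- 2).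
  by rewrite key mulr0 mul0r.
by field; rewrite D1 x1.
Qed.

Let cont_rt (v : R) : 0 < v -> {for v, continuous rt}.
Proof. exact: continuous_powR_gt0. Qed.

Let c_cst (c v : R) : {for v, continuous (fun=> c : R)}.
Proof. exact: cst_continuous. Qed.

Let c_D (th v : R) : 0 < v -> {for v, continuous (Dn th)}.
Proof.
move=> v0; apply: continuousDf; last exact: cvg_id.
apply: continuousDf; first exact: c_cst.
by apply: continuousMf; [exact: c_cst|exact: cont_rt].
Qed.

Let c_kernel (th v : R) : I th -> 0 < v -> {for v, continuous (kernel th)}.
Proof.
move=> Ith v0; apply: continuousMf; first exact: continuous_powR_gt0.
apply: continuousMf.
  apply: continuousDf; last exact: c_cst.
  by apply: continuousMf; [exact: cont_rt|exact: c_cst].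
by apply: continuousV; [rewrite gt_eqF ?Dn_gt0|exact: c_D].
Qed.

Let c_dkernel (th v : R) : I th -> 0 < v -> {for v, continuous (dkernel th)}.
Proof.
move=> Ith v0; apply: continuousMf; first exact: continuous_powR_gt0.
have D1 : Dn th v != 0 by rewrite gt_eqF ?Dn_gt0.
apply: continuousDf; apply: continuousMf.
- apply: continuousDf; last exact: c_cst.
  by apply: continuousMf; [exact: cont_rt|exact: c_cst].
- by apply: continuousV => //; exact: c_D.
- apply: continuousMf.
    apply: continuousDf; last exact: c_cst.
    by apply: continuousMf; [exact: cont_rt|exact: c_cst].
  by apply: continuousMf; [exact: c_cst|exact: cont_rt].
- apply: (@continuousV _ _ (fun v => Dn th v ^+ 2)); first by rewrite expf_neq0.
  by apply: continuousMf; exact: c_D.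
Qed.

(** An integrable majorant, up to a constant factor, of [kernel] and [dkernel],
    uniform in [th]; [v * major v] controls [flux] at both ends of the
    half-line. *)
Let major (v : R) : R := v `^ (tau - 1) / `|1 + v| + v `^ (tau + 2^-1 - 1) / `|1 + v|.

Let major_ge0 v : 0 <= major v.
Proof. by rewrite addr_ge0// divr_ge0 ?powR_ge0. Qed.

Let majorE (v : R) : 0 < v -> major v = v `^ (tau - 1) * (1 + rt v) / (1 + v).
Proof.
move=> v0; rewrite /major ger0_norm ?addr_ge0 ?ltW// -mulrDl; congr (_ / _).
rewrite mulrDr mulr1 -powRD; last by rewrite (gt_eqF v0) implybT.
by congr (_ + _ `^ _); ring.
Qed.

Let int_major : mu.-integrable `]0, +oo[ (EFin \o major).
Proof.
have -> : EFin \o major = ((fun v => (v `^ (tau - 1) / `|1 + v|)%:E) \+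
  (fun v => (v `^ (tau + 2^-1 - 1) / `|1 + v|)%:E))%E by [].
apply: integrableD => //.
  have h : 0 < tau < 1 by apply/andP; split=> //; have := tau2; lra.
  apply: eq_integrable (integrable_beta_kernel h) => //.
  move=> v; rewrite inE/= in_itv/= andbT => v0.
  by rewrite /= gtr0_norm// addr_gt0.
have h : 0 < tau + 2^-1 < 1 by have t0 := tau0; have t2 := tau2; apply/andP; split; lra.
apply: eq_integrable (integrable_beta_kernel h) => //.
move=> v; rewrite inE/= in_itv/= andbT => v0.
by rewrite /= gtr0_norm// addr_gt0.
Qed.

Let DV_le (th v : R) : I th -> 0 < v -> (Dn th v)^-1 <= 2 / (1 + v).
Proof.
move=> Ith v0; have D := Dn_ge Ith v0.
have v1 : 0 < 1 + v by rewrite addr_gt0.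
rewrite -[2 / _]invrK lef_pV2 ?posrE ?Dn_gt0 ?invr_gt0 ?divr_gt0//.
by rewrite invf_div.
Qed.

Let lin_le (x a b s c : R) : 0 < x -> `|a| <= 1 -> `|b| <= 1 -> `|s| <= 1 -> `|c| <= 1 ->
  `|x * (a * s) - b * c| <= 1 + x.
Proof.
move=> x0 a1 b1 s1 c1; rewrite (le_trans (ler_normB _ _))// addrC lerD//.
  by rewrite normrM -[leRHS]mulr1 ler_pM.
rewrite normrM gtr0_norm// ler_piMr ?(ltW x0)// normrM -[leRHS]mulr1.
by rewrite ler_pM.
Qed.

Let kernel_le (th v : R) : I th -> 0 < v -> `|kernel th v| <= 2 * major v.
Proof.
move=> Ith v0; rewrite majorE// /kernel normrM ger0_norm ?powR_ge0//.
have v1 : 0 < 1 + v by rewrite addr_gt0.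
rewrite [leRHS](_ : _ = v `^ (tau - 1) * ((1 + rt v) * (2 / (1 + v)))); last by ring.
rewrite ler_wpM2l ?powR_ge0// normrM.
rewrite ler_pM//; last first.
  by rewrite ger0_norm ?DV_le// invr_ge0 ltW// Dn_gt0.
have := @lin_le (rt v) 1 1 (S' th) (S th) (rt_gt0 v0).
by rewrite !mul1r normr1; apply=> //; exact: sin_max.
Qed.

Let dkernel_le (th v : R) : I th -> 0 < v -> `|dkernel th v| <= 6 * major v.
Proof.
move=> Ith v0; rewrite majorE// /dkernel normrM ger0_norm ?powR_ge0//.
have v1 : 0 < 1 + v by rewrite addr_gt0.
have D0 := Dn_gt0 Ith v0.
have r0 := rt_gt0 v0.
rewrite [leRHS](_ : _ = v `^ (tau - 1) * ((1 + rt v) * 3 * (2 / (1 + v)))); last by ring.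
rewrite ler_wpM2l ?powR_ge0//.
have n1 : `|rt v * ((1 - 2 * tau) * B th) - 2 * tau * A th| <= 1 + rt v.
  by apply: lin_le => //; try exact: cos_max; rewrite ler_norml; have t0 := tau0; have t2 := tau2; apply/andP; split; lra.
have n2 : `|rt v * S' th - S th| <= 1 + rt v.
  have := @lin_le (rt v) 1 1 (S' th) (S th) (rt_gt0 v0).
  by rewrite !mul1r normr1; apply=> //; exact: sin_max.
have n3 : `|2 * sin th * rt v * (Dn th v)^-1| <= 2.
  rewrite normrM (@ger0_norm _ (Dn th v)^-1) ?invr_ge0 ?(ltW D0)// ler_pdivrMr//.
  have D := Dn_ge Ith v0.
  have h : rt v <= (1 + v) / 2.
    by have := sqr_ge0 (1 - rt v); rewrite -[in (1 + v)](rt_sqr v0); nra.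
  rewrite (@le_trans _ _ (2 * rt v))//; last by nra.
  rewrite !normrM (gtr0_norm r0) ger0_norm// -mulrA ler_wpM2l// ler_piMl//.
    exact: ltW.
  exact: sin_max.
have n4 : (Dn th v)^-1 <= 2 / (1 + v) by exact: DV_le.
apply: (@le_trans _ _ ((1 + rt v) * (Dn th v)^-1 + (1 + rt v) * 2 * (Dn th v)^-1)).
  rewrite (le_trans (ler_normD _ _))// lerD//.
    by rewrite normrM ler_pM// ger0_norm// invr_ge0 ltW.
  rewrite (_ : _ * _ * _ = (rt v * S' th - S th) * (2 * sin th * rt v * (Dn th v)^-1) * (Dn th v)^-1).
    by rewrite 2!normrM ler_pM// ?mulr_ge0// ?ler_pM// ger0_norm// invr_ge0 ltW.
  by field; rewrite gt_eqF.
rewrite (_ : _ + _ = (1 + rt v) * 3 * (Dn th v)^-1); last by ring.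
by rewrite ler_wpM2l// mulr_ge0// addr_ge0// ltW.
Qed.

Let flux_le (th v : R) : I th -> 0 < v -> `|flux th v| <= 4 * v * major v.
Proof.
move=> Ith v0; rewrite majorE// /flux powR_predE//.
have v1 : 0 < 1 + v by rewrite addr_gt0.
have D0 := Dn_gt0 Ith v0.
have r0 := rt_gt0 v0.
rewrite (_ : 4 * v * _ = 2 * (v `^ tau * ((1 + rt v) * (2 / (1 + v))))); last first.
  by field; rewrite !gt_eqF.
rewrite mulNr normrN normrM (@ger0_norm _ 2)// ler_wpM2l// normrM ger0_norm ?powR_ge0//.
rewrite ler_wpM2l ?powR_ge0// normrM ler_pM//; last first.
  by rewrite ger0_norm ?invr_ge0 ?(ltW D0)// DV_le.
rewrite (le_trans (ler_normD _ _))// lerD ?cos_max//.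
by rewrite normrM gtr0_norm// ler_piMr ?cos_max// ltW.
Qed.

Let J (th : R) : R := \int[mu]_(v in `]0, +oo[) kernel th v.

Let pos_itv (v : R) : `]0, +oo[%classic v -> 0 < v.
Proof. by rewrite /= in_itv/= andbT. Qed.

Let m_kernel (th : R) : I th -> measurable_fun (`]0%R, +oo[%classic : set R) (kernel th).
Proof.
move=> Ith; apply: open_continuous_measurable_fun => // v /set_mem /pos_itv v0.
exact: c_kernel.
Qed.

Let int_le (f : R -> R) (c : R) : measurable_fun (`]0%R, +oo[%classic : set R) f ->
  (forall v, 0 < v -> `|f v| <= c * major v) ->
  mu.-integrable `]0, +oo[ (EFin \o f).
Proof.
move=> mf fb.
have h : mu.-integrable `]0, +oo[ (EFin \o (fun v => c * major v)).
  exact: RintegrableZ int_major.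
apply: le_integrable h => //; first exact/measurable_EFinP.
by move=> v /pos_itv v0; rewrite /= lee_fin (le_trans (fb v v0))// ler_norm.
Qed.

Let int_kernel (th : R) : I th -> mu.-integrable `]0, +oo[ (EFin \o kernel th).
Proof. by move=> Ith; apply: (int_le (c := 2)); [exact: m_kernel|move=> v v0; exact: kernel_le]. Qed.

Let int_dkernel (th : R) : I th -> mu.-integrable `]0, +oo[ (EFin \o dkernel th).
Proof.
move=> Ith; apply: (int_le (c := 6)); last by move=> v v0; exact: dkernel_le.
apply: open_continuous_measurable_fun => // v /set_mem /pos_itv v0.
exact: c_dkernel.
Qed.

Let major_cvg0 : v * major v @[v --> 0^'+] --> 0.
Proof.
have h : v `^ tau + v `^ (tau + 2^-1) @[v --> 0^'+] --> (0 + 0 : R).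
  by apply: cvgD; apply: powR_cvg0; rewrite ?addr_gt0.
rewrite addr0 in h.
apply: squeeze_cvgr (cvg_cst 0) h; near=> v.
have v0 : 0 < v by near: v; exact: nbhs_right_gt.
have v1 : 1 <= `|1 + v| by rewrite ger0_norm ?lerDl ?addr_ge0 ?(ltW v0).
rewrite mulr_ge0 ?(ltW v0)//=.
rewrite /major !powR_predE// mulrDr lerD//.
  by rewrite mulrA (mulrC v) divfK ?gt_eqF// ler_piMr ?powR_ge0// invf_le1// (lt_le_trans _ v1).
by rewrite mulrA (mulrC v) divfK ?gt_eqF// ler_piMr ?powR_ge0// invf_le1// (lt_le_trans _ v1).
Unshelve. all: by end_near. Qed.

Let major_cvgy : v * major v @[v --> +oo] --> 0.
Proof.
have h : v `^ (tau - 1) + v `^ (tau + 2^-1 - 1) @[v --> +oo] --> (0 + 0 : R).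
  by apply: cvgD; apply: powR_cvgy; have := tau2; lra.
rewrite addr0 in h.
apply: squeeze_cvgr (cvg_cst 0) h; near=> v.
have v0 : 0 < v by near: v; exact: nbhs_pinfty_gt.
rewrite mulr_ge0 ?(ltW v0)//=.
have n0 : 0 < `|1 + v| by rewrite gtr0_norm ?addr_gt0.
rewrite /major -mulrDl mulrCA ler_piMr ?addr_ge0 ?powR_ge0// ler_pdivrMr// mul1r.
by rewrite gtr0_norm ?addr_gt0// lerDr.
Unshelve. all: by end_near. Qed.

Let int_dkernel0 (th : R) : I th -> \int[mu]_(v in `]0, +oo[) dkernel th v = 0.
Proof.
move=> Ith; rewrite -[RHS](subrr 0).
have squeeze (F : set_system R) : Filter F -> (\forall v \near F, 0 < v) ->
    v * major v @[v --> F] --> 0 -> flux th v @[v --> F] --> 0.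
  move=> FF F0 h.
  apply/norm_cvg0P.
  have h4 : 4 * (v * major v) @[v --> F] --> 0.
    by rewrite -(mulr0 4); apply: cvgM => //; exact: cvg_cst.
  apply: squeeze_cvgr (cvg_cst 0) h4; near=> v.
  by rewrite normr_ge0/= mulrA; apply: flux_le => //; near: v.
apply: (@FTC_oy R (dkernel th) (flux th)).
- by move=> v v0; exact: c_dkernel.
- by move=> v v0; exact: d_flux.
- by apply: (squeeze (0^'+)); [exact: nbhs_right_gt|exact: major_cvg0].
- by apply: (squeeze +oo%R); [exact: nbhs_pinfty_gt|exact: major_cvgy].
- exact: int_dkernel.
Unshelve. all: by end_near. Qed.

Let dJ (th : R) : I th -> is_derive th 1 J 0.
Proof.
move=> Ith.
have dkernelE x v : I x -> 0 < v -> partial1of2 kernel x v = dkernel x v.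
  by move=> Ix v0; rewrite partial1of2E; have [_] := d_kernel Ix v0.
have G0 v : 0 <= 6 * major v by rewrite mulr_ge0.
have intG : mu.-integrable `]0, +oo[ (EFin \o (fun v => 6 * major v)).
  exact: RintegrableZ int_major.
have der x v : I x -> `]0, +oo[%classic v -> derivable (kernel^~ v) x 1.
  by move=> Ix /pos_itv v0; have [] := d_kernel Ix v0.
have Gub x v : I x -> `]0, +oo[%classic v -> `|partial1of2 kernel x v| <= 6 * major v.
  by move=> Ix /pos_itv v0; rewrite dkernelE// dkernel_le.
have mD : (measurable : set (set (measurableTypeR R))) `]0%R, +oo[%classic by exact: measurable_itv.
apply: DeriveDef.
  have hd := @derivable_under_integral R _ _ mu kernel _ mD th _ _ Ith int_kernel der _ G0 intG Gub.
  exact: hd.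
rewrite -derive1E.
rewrite (@differentiation_under_integral R _ _ mu kernel _ mD th _ _ Ith int_kernel der _ G0 intG Gub).
rewrite -[RHS](int_dkernel0 Ith); apply: eq_Rintegral => v /set_mem/pos_itv v0.
exact: dkernelE.
Qed.

Let I0 : I 0.
Proof. by rewrite /I/= in_itv/=; have := pi_ge2 R; lra. Qed.

Let Ip : I (pi / 2).
Proof. by rewrite /I/= in_itv/=; have := pi_ge2 R; lra. Qed.

Let J0 : J 0 = 0.
Proof.
rewrite /J -[RHS](@Rintegral_set0 _ _ _ mu (fun=> 0)) /Rintegral; congr fine.
rewrite integral_set0 integral0_eq// => v _.
by rewrite /kernel /S /S' !mulr0 sin0 mulr0 subrr mul0r mulr0.
Qed.

Let Jp : J (pi / 2) = 0.
Proof.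
have pi0 : 0 < pi / 2 :> R by rewrite divr_gt0// pi_gt0.
have sI x : x \in `[0, pi / 2] -> I x.
  by rewrite /I/= !in_itv/= => /andP[]; have := pi_ge2 R; lra.
have [||c _] := @MVT R J (fun=> 0) 0 (pi / 2) pi0.
- by move=> x /subset_itv_oo_cc/sI; exact: dJ.
- apply: derivable_within_continuous => x /sI Ix.
  by have [] := dJ Ix.
by rewrite J0 subr0 mul0r.
Qed.

(** [J th] is the integral of [kernel th] over the half-line. Its derivative
    vanishes ([dJ]), since the derivative of the kernel in [th] is that of [flux
    th] in [v]; and [J 0 = 0] because [kernel 0 = 0]. At [th = pi / 2] the
    denominator is [1 + v], and [J] is the difference of the two sides, written
    as beta integrals. *)
Lemma Gamma_half_shift :
  sin (tau * pi) * (Gamma tau * Gamma (1 - tau)) =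
  sin ((2^-1 - tau) * pi) * (Gamma (2^-1 - tau) * Gamma (1 - (2^-1 - tau))).
Proof.
have t0 := tau0; have t2 := tau2.
have h1 : 0 < tau < 1 by apply/andP; split=> //; lra.
have h2 : 0 < tau + 2^-1 < 1 by apply/andP; split; lra.
have -> : 1 - (2^-1 - tau) = tau + 2^-1 by lra.
have e2 : 2^-1 - tau = 1 - (tau + 2^-1) by lra.
have g2 : Gamma (2^-1 - tau) * Gamma (tau + 2^-1) =
    \int[mu]_(v in `]0%R, +oo[) (v `^ (tau + 2^-1 - 1) / (1 + v)).
  by rewrite mulrC e2; exact: Gamma_refl h2.
rewrite g2 (Gamma_refl h1).
apply/esym/eqP; rewrite -subr_eq0; apply/eqP; rewrite -[RHS]Jp.
have i1 := integrable_beta_kernel h1; have i2 := integrable_beta_kernel h2.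
rewrite -!RintegralZl//= -RintegralB//=; last 2 first.
  exact: RintegrableZ i2.
  exact: RintegrableZ i1.
apply: eq_Rintegral => v /set_mem/pos_itv v0.
rewrite /kernel /Dn cos_pihalf mulr0 mul0r addr0 /S' /S.
rewrite (_ : (1 - 2 * tau) * (pi / 2) = (2^-1 - tau) * pi); last by field.
rewrite (_ : 2 * tau * (pi / 2) = tau * pi); last by field.
rewrite (_ : tau + 2^-1 - 1 = tau - 1 + 2^-1); last by ring.
rewrite powRD; last by rewrite (gt_eqF v0) implybT.
by rewrite /rt; ring.
Qed.

End half_shift.

(** * Lebesgue measure on row vectors: continuity, Tonelli, affine maps *)

Section measurable_rV_continuous.
Context {R : realType} {n : nat}.
Implicit Types (v : 'rV[R]_n).

Let cell (k : nat) (m : 'rV[int]_n) : set 'rV[R]_n :=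
  [set v | forall i, (m ord0 i)%:~R / k.+1%:R <= v ord0 i < ((m ord0 i)%:~R + 1) / k.+1%:R].

Let mcell k m : measurable (cell k m).
Proof.
rewrite (_ : cell k m = \bigcap_(i in [set: 'I_n])
    ((fun v : 'rV[R]_n => v ord0 i) @^-1` `[(m ord0 i)%:~R / k.+1%:R, ((m ord0 i)%:~R + 1) / k.+1%:R[%classic)).
  apply: fin_bigcap_measurable => // i _.
  by rewrite -[X in measurable X]setTI; apply: measurable_coor.
apply/seteqP; split => [v h i _|v h i]; first by rewrite /= in_itv/=; exact: h.
by have := h i I; rewrite /= in_itv.
Qed.

(** The norm is the sup norm, so an open set is the union of the cubes of side
    [1 / (k + 1)] with vertices in the corresponding lattice which it contains,
    and there are countably many of these. *)
Lemma open_measurable_rV (U : set 'rV[R]_n) : open U -> measurable U.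
Proof.
move=> oU.
rewrite (_ : U = \bigcup_(p in [set p : nat * 'rV[int]_n | cell p.1 p.2 `<=` U]) cell p.1 p.2).
  rewrite bigcup_mkcond; apply: countable_bigcupT_measurable => [|p]; first exact: countableP.
  by case: ifP => // _; exact: mcell.
apply/seteqP; split => [v Uv|v [p /= sub]]; last exact: sub.
have /nbhs_ballP[e /= e0 sub] : nbhs v U by exact: open_nbhs_nbhs.
have [k ke] : exists k : nat, e^-1 < k.+1%:R.
  by exists (Num.truncn e^-1); rewrite truncnS_gt.
have k0 : 0 < k.+1%:R :> R by [].
have k1 : k.+1%:R^-1 < e by rewrite -[e]invrK ltf_pV2 ?posrE ?invr_gt0.
pose m : 'rV[int]_n := \row_i Num.floor (v ord0 i * k.+1%:R).
exists (k, m) => /=; last first.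
  move=> i; rewrite /m mxE ler_pdivrMr// ltr_pdivlMr//.
  by rewrite floor_le -intrD1 floorD1_gt.
move=> w cw; apply: sub; split=> // i j; rewrite ord1 /ball/=.
have := cw j; rewrite /m mxE => /andP[w1 w2].
have := floor_le (v ord0 j * k.+1%:R).
have := floorD1_gt (v ord0 j * k.+1%:R).
rewrite intrD -ltr_pdivlMr// -ler_pdivrMr// => v2 v1.
rewrite (lt_trans _ k1)// ltr_norml.
move: w1 w2 v1 v2; set f := (Num.floor _)%:~R; rewrite mulrDl mul1r.
move=> w1 w2 v1 v2; apply/andP; split.
  by rewrite ltrBrDl ltrBlDr (lt_le_trans w2)// lerD2r.
by rewrite ltrBlDl (lt_le_trans v2)// lerD2r.
Qed.

Lemma continuous_measurable_rV (f : 'rV[R]_n -> R) :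
  continuous f -> measurable_fun setT f.
Proof.
move=> cf; apply: (measurability _ (@RGenOpens.measurableE R)).
move=> _ [_ [a [b ->] <-]]; rewrite setTI.
apply: open_measurable_rV; apply: open_comp => //; exact: interval_open.
Qed.

End measurable_rV_continuous.

Section lebesgue_rV_tonelli.
Context {R : realType}.
Notation mu := (@lebesgue_measure R).
Local Open Scope ereal_scope.
Variable n : nat.

Lemma ge0_integral_rV_consr (f : 'rV[R]_n.+1 -> \bar R) :
  measurable_fun setT f -> (forall v, 0 <= f v) ->
  \int[lebesgue_rV n.+1]_v f v = \int[mu]_a \int[lebesgue_rV n]_v f (rV_cons (a, v)).
Proof.
move=> mf f0; rewrite /= ge0_integral_pushforward//; last exact: measurable_rV_cons.
rewrite preimage_setT fubini_tonelli1//; last by move=> p; exact: f0.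
by apply: measurableT_comp => //; exact: measurable_rV_cons.
Qed.

Lemma integrable_rV_cons (f : 'rV[R]_n.+1 -> \bar R) :
  (lebesgue_rV n.+1).-integrable setT f ->
  (mu \x lebesgue_rV n).-integrable setT (f \o @rV_cons R n).
Proof.
move=> /integrableP[mf fi]; apply/integrableP; split.
  by apply: measurableT_comp => //; exact: measurable_rV_cons.
move: fi; rewrite /= ge0_integral_pushforward//; last first.
- exact: measurableT_comp.
- exact: measurable_rV_cons.
Qed.

Lemma integral_rV_cons (f : 'rV[R]_n.+1 -> \bar R) :
  (lebesgue_rV n.+1).-integrable setT f ->
  \int[lebesgue_rV n.+1]_v f v = \int[mu \x lebesgue_rV n]_p f (rV_cons p).
Proof.
move=> fi; have := integrable_rV_cons fi => fi'.
rewrite /= integral_pushforward//.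
- exact: measurable_rV_cons.
- by case/integrableP: fi.
Qed.

End lebesgue_rV_tonelli.

Section affine_rV.
Context {R : realType}.
Local Open Scope ereal_scope.

Lemma rV0_eq (v w : 'rV[R]_0) : v = w.
Proof. by apply/rowP => -[]. Qed.

Lemma rV_consD (a b : R) n (v w : 'rV[R]_n) :
  (rV_cons (a, v) + rV_cons (b, w))%R = rV_cons ((a + b)%R, (v + w)%R).
Proof.
apply/rowP => i; rewrite mxE; case: (unliftP ord0 i) => [j ->|->].
  by rewrite !rV_cons_lift mxE.
have h c (u : 'rV[R]_n) : rV_cons (c, u) ord0 ord0 = c := congr1 fst (rV_consK (c, u)).
by rewrite !h.
Qed.

Lemma rV_cons0 n (a : R) (v : 'rV[R]_n) : rV_cons (a, v) ord0 ord0 = a.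
Proof. exact: (congr1 fst (rV_consK (a, v))). Qed.

Lemma rV_consZ (t a : R) n (v : 'rV[R]_n) :
  (t *: rV_cons (a, v))%R = rV_cons ((t * a)%R, (t *: v)%R).
Proof.
apply/rowP => i; rewrite mxE; case: (unliftP ord0 i) => [j ->|->].
  by rewrite !rV_cons_lift mxE.
by rewrite !rV_cons0.
Qed.

Lemma measurable_rV_affine n (x : 'rV[R]_n) (t : R) :
  measurable_fun setT (fun z : 'rV[R]_n => x + t *: z)%R.
Proof.
apply: measurable_fun_coorP => i.
rewrite (_ : (fun _ => _) = (fun z : 'rV[R]_n => x ord0 i + t * z ord0 i)%R); last first.
  by apply/funext => z; rewrite !mxE.
by apply: measurable_funD => //; apply: measurable_funM => //; exact: measurable_coor.
Qed.

(** One coordinate at a time, by Tonelli's theorem and the one-dimensional case.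
    *)
Lemma ge0_integral_rV_affine n (x : 'rV[R]_n) (t : R) (f : 'rV[R]_n -> \bar R) :
  (0 < t)%R -> measurable_fun setT f -> (forall v, 0 <= f v) ->
  \int[lebesgue_rV n]_v f v = (t ^+ n)%:E * \int[lebesgue_rV n]_z f (x + t *: z)%R.
Proof.
move=> t0; elim: n => [|n ih] in x f *.
  move=> mf f0; rewrite expr0 mul1e; apply: eq_integral => v _.
  by congr f; exact: rV0_eq.
move=> mf f0.
have mfc : measurable_fun setT (f \o @rV_cons R n).
  by apply: measurableT_comp => //; exact: measurable_rV_cons.
have mfa : measurable_fun setT (fun z : 'rV[R]_n.+1 => f (x + t *: z)%R).
  by apply: (measurableT_comp mf); exact: measurable_rV_affine.
have tn0 : (0 <= t ^+ n)%R by rewrite exprn_ge0// ltW.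
rewrite ge0_integral_rV_consr// ge0_integral_rV_consr//.
rewrite [LHS](@ge0_integral_affine R (x ord0 ord0) t _ t0); first last.
- by move=> a; exact: integral_ge0.
- exact: (@measurable_fun_fubini_tonelli_F _ _ _ _ _ (lebesgue_rV n) _ mfc (fun p => f0 _)).
rewrite exprS EFinM -muleA; congr (_ * _).
rewrite -ge0_integralZl_EFin//; last 2 first.
- by move=> a _; exact: integral_ge0.
- apply: (@measurable_fun_fubini_tonelli_F _ _ _ _ _ (lebesgue_rV n) ((fun z : 'rV[R]_n.+1 => f (x + t *: z)%R) \o @rV_cons R n)) => //; last by move=> p; exact: f0.
  by apply: measurableT_comp => //; exact: measurable_rV_cons.
apply: eq_integral => a _.
rewrite (ih (rV_uncons x).2)//; last first.
  exact: (measurableT_comp mfc).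
congr (_ * _); apply: eq_integral => v _; congr f.
rewrite rV_consZ.
have {3}-> : x = rV_cons (x ord0 ord0, (rV_uncons x).2) by exact: esym (rV_unconsK x).
by rewrite rV_consD.
Qed.

Lemma Rintegrable_rV_affine n (x : 'rV[R]_n) (t : R) (f : 'rV[R]_n -> R) :
  (0 < t)%R -> measurable_fun setT f ->
  (lebesgue_rV n).-integrable setT (EFin \o (fun z => f (x + t *: z)%R)) ->
  (lebesgue_rV n).-integrable setT (EFin \o f).
Proof.
move=> t0 mf /integrableP[_ fi]; apply/integrableP; split; first exact/measurable_EFinP.
rewrite (@ge0_integral_rV_affine n x t)//.
  by rewrite lte_mul_pinfty// ?lee_fin ?exprn_ge0 ?ltW.
by apply: measurableT_comp => //; exact/measurable_EFinP.
Qed.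

Lemma Rintegral_rV_affine n (x : 'rV[R]_n) (t : R) (f : 'rV[R]_n -> R) :
  (0 < t)%R -> measurable_fun setT f ->
  (lebesgue_rV n).-integrable setT (EFin \o (fun z => f (x + t *: z)%R)) ->
  (\int[lebesgue_rV n]_v f v = t ^+ n * \int[lebesgue_rV n]_z f (x + t *: z))%R.
Proof.
move=> t0 mf fi.
have tn0 : (0 <= t ^+ n)%R by rewrite exprn_ge0// ltW.
have mf' : measurable_fun setT (EFin \o f) by exact/measurable_EFinP.
rewrite /Rintegral integralE [in RHS]integralE.
rewrite (@ge0_integral_rV_affine n x t (EFin \o f)^\+)//; last exact: measurable_funepos.
rewrite (@ge0_integral_rV_affine n x t (EFin \o f)^\-)//; last exact: measurable_funeneg.
pose fx := EFin \o (fun z : 'rV[R]_n => f (x + t *: z)%R).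
pose P := \int[lebesgue_rV n]_z fx^\+ z; pose N := \int[lebesgue_rV n]_z fx^\- z.
have -> : \int[lebesgue_rV n]_z (EFin \o f)^\+ (x + t *: z)%R = P.
  by apply: eq_integral => z _; rewrite !funeposE.
have -> : \int[lebesgue_rV n]_z (EFin \o f)^\- (x + t *: z)%R = N.
  by apply: eq_integral => z _; rewrite !funenegE.
transitivity (t ^+ n * fine (P - N))%R; last by [].
have Pf : P \is a fin_num by exact: (integrable_pos_fin_num _ fi).
have Nf : N \is a fin_num by exact: (integrable_neg_fin_num _ fi).
by rewrite -(fineK Pf) -(fineK Nf) -!EFinM -!EFinB/= mulrBr.
Qed.

End affine_rV.

(** * Weights on the unit ball *)

Section sqn.
Context {R : realType} {n : nat}.
Implicit Types z : 'rV[R]_n.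

Definition sqn z : R := \sum_i z ord0 i ^+ 2.

Lemma sqn_ge0 z : 0 <= sqn z.
Proof. by apply: sumr_ge0 => i _; rewrite sqr_ge0. Qed.

Lemma sqnZ t z : sqn (t *: z) = t ^+ 2 * sqn z.
Proof. by rewrite /sqn mulr_sumr; apply: eq_bigr => i _; rewrite mxE exprMn. Qed.

Lemma measurable_sqn : measurable_fun setT (@sqn).
Proof.
apply: measurable_sum => i; apply: measurable_funX; exact: measurable_coor.
Qed.

Lemma coord_le_sqn z i : z ord0 i ^+ 2 <= sqn z.
Proof.
by rewrite /sqn (bigD1 i)//= lerDl sumr_ge0// => j _; rewrite sqr_ge0.
Qed.

End sqn.

Section gauss_rV.
Context {R : realType}.
Notation mu := (@lebesgue_measure R).
Local Open Scope ereal_scope.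

Lemma sqn_cons n (a : R) (v : 'rV[R]_n) : (sqn (rV_cons (a, v)) = a ^+ 2 + sqn v)%R.
Proof.
rewrite /sqn big_ord_recl rV_cons0; congr (_ + _)%R.
by apply: eq_bigr => i _; rewrite rV_cons_lift.
Qed.

Lemma integral_gauss_rV n :
  \int[lebesgue_rV n]_z (expR (- sqn z))%:E = ((Num.sqrt pi : R) ^+ n)%:E.
Proof.
elim: n => [|n ih].
  rewrite /= integral_dirac//; last first.
    by apply/measurable_EFinP; do 2 apply: measurableT_comp => //; exact: measurable_sqn.
  by rewrite [X in X * _]diracE in_setT mul1e /sqn big_ord0 oppr0 expR0.
have mg k : measurable_fun setT (fun z : 'rV[R]_k => (expR (- sqn z))%:E).
  apply/measurable_EFinP; do 2 apply: measurableT_comp => //.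
  exact: measurable_sqn.
rewrite ge0_integral_rV_consr//.
transitivity (\int[mu]_a (((Num.sqrt pi) ^+ n)%:E * (gauss_fun a)%:E)).
  apply: eq_integral => a _; rewrite -ih.
  rewrite -(@ge0_integralZr _ _ _ (lebesgue_rV n) setT)//; [|exact: mg|by rewrite lee_fin gauss_fun_ge0].
  apply: eq_integral => v _; rewrite sqn_cons opprD expRD muleC -EFinM.
  by [].
rewrite ge0_integralZl_EFin ?exprn_ge0 ?sqrtr_ge0//.
- by rewrite integralT_gauss exprSr EFinM.
- by move=> a _; rewrite lee_fin gauss_fun_ge0.
- by apply/measurable_EFinP; exact: measurable_gauss_fun.
Qed.

End gauss_rV.

Section ball_weight.
Context {R : realType} (n : nat) (b : R).
Notation mu := (@lebesgue_measure R).
Local Open Scope ereal_scope.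
Hypothesis b1 : (0 < b + 1)%R.

Let ballE : \bar R :=
  \int[lebesgue_rV n]_z (if (sqn z < 1)%R then ((1 - sqn z) `^ b)%:E else 0).

Let K (p : 'rV[R]_n * R) : \bar R :=
  if (sqn p.1 < p.2)%R then ((p.2 - sqn p.1) `^ b * expR (- p.2))%:E else 0.

Let msq1 : measurable_fun setT (fun p : 'rV[R]_n * R => sqn p.1).
Proof. by apply: measurableT_comp => //; exact: measurable_sqn. Qed.

Let mK : measurable_fun setT K.
Proof.
apply: measurable_fun_if => //.
- exact: measurable_fun_ltr.
- apply: measurable_funTS; apply/measurable_EFinP; apply: measurable_funM.
    apply: (measurableT_comp (measurable_powR b)).
    exact: measurable_funB.
  by do 2 apply: measurableT_comp => //.
Qed.

Let K0 p : 0 <= K p.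
Proof. by rewrite /K; case: ifP => // _; rewrite lee_fin mulr_ge0 ?powR_ge0 ?expR_ge0. Qed.

Let mball : measurable_fun setT
  (fun z : 'rV[R]_n => if (sqn z < 1)%R then ((1 - sqn z) `^ b)%:E else 0).
Proof.
apply: measurable_fun_if => //.
- by apply: measurable_fun_ltr => //; exact: measurable_sqn.
- apply: measurable_funTS; apply/measurable_EFinP.
  apply: (measurableT_comp (measurable_powR b)).
  by apply: measurable_funB => //; exact: measurable_sqn.
Qed.

(** Both sides are the integral of [(r - |z|^2)^b e^(-r)] over [|z|^2 < r]. With
    [z] fixed, a translation of [r] leaves a Gaussian times [egamma (b + 1)];
    with [r] fixed, scaling [z] by the square root of [r] brings back the unit
    ball and a power of [r]. *)
Lemma ball_weight_egamma :
  ballE * egamma (b + n%:R / 2 + 1)%R = ((Num.sqrt pi : R) ^+ n)%:E * egamma (b + 1)%R.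
Proof.
have ball0 : 0 <= ballE.
  by apply: integral_ge0 => z _; case: ifP => // _; rewrite lee_fin powR_ge0.
transitivity (\int[lebesgue_rV n]_z \int[mu]_r K (z, r)); last first.
  transitivity (\int[lebesgue_rV n]_z ((expR (- sqn z))%:E * egamma (b + 1)%R)); last first.
    rewrite ge0_integralZr ?egamma_ge0//.
    + by rewrite integral_gauss_rV.
    + apply/measurable_EFinP; do 2 apply: measurableT_comp => //; exact: measurable_sqn.
  apply: eq_integral => z _.
  rewrite [LHS](@ge0_integral_affine R (sqn z) 1 _ ltr01); first last.
  - by move=> x; exact: K0.
  - exact: measurableT_comp mK (pair1_measurable _).
  rewrite mul1e /egamma -ge0_integralZl_EFin ?expR_ge0//; first last.
  - exact: measurable_fun_gamma.
  - by move=> r _; case: ifP => // _; rewrite lee_fin mulr_ge0 ?powR_ge0 ?expR_ge0.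
  apply: eq_integral => r _; rewrite /K/= mul1r ltrDl addrK.
  case: ifPn => _; last by rewrite mule0.
  rewrite addrAC subrr add0r -EFinM opprD expRD; congr EFin; ring.
rewrite (@fubini_tonelli _ _ _ _ _ (lebesgue_rV n) mu _ mK K0).
rewrite /egamma -ge0_integralZl//; first last.
- by move=> r _; case: ifP => // _; rewrite lee_fin mulr_ge0 ?powR_ge0 ?expR_ge0.
- exact: measurable_fun_gamma.
apply: eq_integral => r _; case: ifPn => r0; last first.
  rewrite mule0 integral0_eq// => z _; rewrite /K/=; case: ifPn => // zr.
  by move: r0; rewrite (le_lt_trans (sqn_ge0 z) zr).
have s0 : (0 < Num.sqrt r)%R by rewrite sqrtr_gt0.
have s2 : (Num.sqrt r ^+ 2 = r)%R by rewrite sqr_sqrtr// ltW.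
symmetry; rewrite [LHS](@ge0_integral_rV_affine R n 0%R (Num.sqrt r) _ s0)//; last first.
  exact: measurableT_comp mK (pair2_measurable _).
transitivity ((Num.sqrt r ^+ n)%:E * ((r `^ b * expR (- r))%:E * ballE)).
  congr (_ * _); rewrite -ge0_integralZl_EFin ?mulr_ge0 ?powR_ge0 ?expR_ge0//; last first.
    by move=> z _; case: ifP => // _; rewrite lee_fin powR_ge0.
  apply: eq_integral => z _; rewrite /K/= add0r sqnZ s2 gtr_pMr//.
  case: ifPn => z1; last by rewrite mule0.
  rewrite -EFinM -[X in (X - _)%R]mulr1 -mulrBr powRM ?(ltW r0)// ?subr_ge0 ?(ltW z1)//.
  by congr EFin; ring.
rewrite muleA -EFinM muleC; congr (_ * _%:E).
rewrite mulrA addrK; congr (_ * _)%R.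
rewrite powRD; last by rewrite (gt_eqF r0) implybT.
rewrite mulrC; congr (_ * _)%R.
by rewrite -powR_mulrn ?sqrtr_ge0// -powR12_sqrt ?ltW// -powRrM mulrC.
Qed.

End ball_weight.

Section slices.
Context {R : realType}.
Notation mu := (@lebesgue_measure R).
Local Open Scope ereal_scope.

Lemma basis_vector0 n : basis_vector ord0 = rV_cons (1%R, 0%R) :> 'rV[R]_n.+1.
Proof.
apply/rowP => i; rewrite mxE eqxx/=; case: (unliftP ord0 i) => [j ->|->].
  by rewrite rV_cons_lift mxE.
by rewrite rV_cons0 eqxx.
Qed.

Lemma basis_vector_lift n (j : 'I_n) :
  basis_vector (lift ord0 j) = rV_cons (0%R, basis_vector j) :> 'rV[R]_n.+1.
Proof.
apply/rowP => i; rewrite mxE eqxx/=; case: (unliftP ord0 i) => [k ->|->].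
  by rewrite rV_cons_lift mxE eqxx/= (inj_eq lift_inj).
by rewrite rV_cons0.
Qed.

(** Fubini along one axis. Since the slices only matter through the vanishing of
    their integrals, the induction on the dimension can fix the coordinates
    before the [i]-th one after another. *)
Lemma integral_slices0 n (i : 'I_n) (G : 'rV[R]_n -> R) :
  (lebesgue_rV n).-integrable setT (EFin \o G) ->
  (forall z, mu.-integrable setT (EFin \o (fun s => G (z + s *: basis_vector i)%R)) ->
     \int[mu]_s (G (z + s *: basis_vector i)%R)%:E = 0) ->
  \int[lebesgue_rV n]_z (G z)%:E = 0.
Proof.
elim: n => [|n ih] in i G *; first by case: i.
move=> Gi hG; have Gi' := integrable_rV_cons Gi.
rewrite (integral_rV_cons Gi).
case: (unliftP ord0 i) => [j|] ei; rewrite {i}ei in hG.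
  rewrite -(integral12_prod_meas1 Gi').
  transitivity (\int[mu]_a (cst 0 a : \bar R)); last by rewrite integral0.
  apply: ae_eq_integral => //.
    exact: (measurable_fubini_F Gi').
  have := ae_integrable1 Gi'; apply: filterS => a Ga _ /=.
  rewrite /fubini_F/=; apply: (ih j (fun v => G (rV_cons (a, v)))) => // v vi.
  have h s : (rV_cons (a, v + s *: basis_vector j) = rV_cons (a, v) + s *: basis_vector (lift ord0 j))%R.
    by rewrite basis_vector_lift rV_consZ rV_consD mulr0 addr0.
  under eq_integral do rewrite h.
  apply: hG; apply: eq_integrable vi => // s _ /=.
  by rewrite h.
rewrite -(integral21_prod_meas1 Gi').
transitivity (\int[lebesgue_rV n]_a (cst 0 a : \bar R)); last by rewrite integral0.
apply: ae_eq_integral => //.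
  exact: (measurable_fubini_G Gi').
have := ae_integrable2 Gi'; apply: filterS => v Gv _ /=.
rewrite /fubini_G/=.
have h s : (rV_cons (s, v) = rV_cons (0, v) + s *: basis_vector ord0)%R.
  by rewrite basis_vector0 rV_consZ rV_consD scaler0 mulr1 add0r addr0.
under eq_integral do rewrite h.
apply: hG; apply: eq_integrable Gv => // s _ /=.
by rewrite h.
Qed.

End slices.

Section ball_weights.
Context {R : realType} (n : nat) (b : R).
Notation mu := (@lebesgue_measure R).
Hypothesis b1 : 0 < b + 1.

Definition uball : set 'rV[R]_n := [set z | sqn z < 1].

Lemma measurable_uball : measurable uball.
Proof.
rewrite (_ : uball = sqn @^-1` `]-oo, 1[%classic); last first.
  by apply/seteqP; split=> z; rewrite /= in_itv.
by rewrite -[X in measurable X]setTI; apply: measurable_sqn.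
Qed.

Definition bweight (z : 'rV[R]_n) : R := (1 - sqn z) `^ b.

Lemma measurable_bweight : measurable_fun setT bweight.
Proof.
apply: (measurableT_comp (measurable_powR b)).
by apply: measurable_funB => //; exact: measurable_sqn.
Qed.

Lemma bweight_ge0 z : 0 <= bweight z. Proof. exact: powR_ge0. Qed.

(** For [b < 0] the weight is unbounded near the sphere; its integral is finite
    because its product with a nonzero [egamma] is. *)
Lemma integrable_bweight : (lebesgue_rV n).-integrable uball (EFin \o bweight).
Proof.
apply/integrableP; split.
  by apply: measurable_funTS; apply/measurable_EFinP; exact: measurable_bweight.
under eq_integral do rewrite /= ger0_norm ?bweight_ge0//.
rewrite (@integral_if _ _ _ _ _ (fun z => sqn z < 1)); last by [].
have h := @ball_weight_egamma R n b.
have g0 : 0 < b + n%:R / 2 + 1 by rewrite addrAC ltr_wpDr// divr_ge0.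
rewrite ltNge leye_eq; apply/negP => /eqP e.
move: h; rewrite e !GammaE// gt0_mulye ?lte_fin ?Gamma_gt0// -EFinM.
Qed.

Lemma integral_bweight : \int[lebesgue_rV n]_(z in uball) bweight z * Gamma (b + n%:R / 2 + 1)
  = (Num.sqrt pi) ^+ n * Gamma (b + 1).
Proof.
have h := @ball_weight_egamma R n b.
have g0 : 0 < b + n%:R / 2 + 1 by rewrite addrAC ltr_wpDr// divr_ge0.
have e1 := GammaE g0; have e2 := GammaE b1.
apply: EFin_inj; rewrite !EFinM -e1 -e2 -h; apply: (congr1 (fun x => x * _)%E).
rewrite /Rintegral fineK; last by apply: integrable_fin_num integrable_bweight; exact: measurable_uball.
by rewrite (@integral_if _ _ _ _ _ (fun z => sqn z < 1)).
Qed.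

Lemma Rintegrable_bweightM (f : 'rV[R]_n -> R) (M : R) : measurable_fun setT f ->
  (forall z, uball z -> `|f z| <= M) ->
  (lebesgue_rV n).-integrable uball (EFin \o (fun z => bweight z * f z)).
Proof.
move=> mf fM; have mu' := measurable_uball.
have h := RintegrableZ mu' M integrable_bweight.
apply: le_integrable h => //.
  apply: measurable_funTS; apply/measurable_EFinP.
  by apply: measurable_funM => //; exact: measurable_bweight.
move=> z uz; rewrite /= lee_fin normrM ger0_norm ?bweight_ge0// mulrC.
rewrite (le_trans _ (ler_norm _))// ler_wpM2r ?bweight_ge0//; exact: fM.
Qed.

End ball_weights.

Arguments uball {R n}.

Lemma uball_coord_le1 {R : realType} {n : nat} (z : 'rV[R]_n) i : uball z -> `|z ord0 i| <= 1.
Proof.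
move=> uz; rewrite -(@ler_pXn2r _ 2)// ?nnegrE// expr1n real_normK ?num_real//.
by rewrite (le_trans (coord_le_sqn z i))// ltW.
Qed.

Section ball_by_parts_formula.
Context {R : realType} (n : nat) (b : R).
Notation mu := (@lebesgue_measure R).
Hypothesis b1 : 0 < b + 1.
Variables (i : 'I_n) (f f' : 'rV[R]_n -> R) (M : R).
Hypothesis df : forall z, is_derive z (basis_vector i) f (f' z).
Hypothesis cf : continuous f.
Hypothesis cf' : continuous f'.
Hypothesis fM : forall z, uball z -> `|f z| <= M.
Hypothesis f'M : forall z, uball z -> `|f' z| <= M.

Let g (z : 'rV[R]_n) : R :=
  bweight (b + 1) z * f' z - 2 * (b + 1) * (bweight b z * (z ord0 i * f z)).

Let i1 : (lebesgue_rV n).-integrable uball (EFin \o (fun z => bweight (b + 1) z * f' z)).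
Proof.
apply: (@Rintegrable_bweightM R n (b + 1) _ _ M) => //; first by rewrite addr_gt0.
exact: continuous_measurable_rV.
Qed.

Let i2 : (lebesgue_rV n).-integrable uball (EFin \o (fun z => bweight b z * (z ord0 i * f z))).
Proof.
apply: (@Rintegrable_bweightM R n b b1 _ M) => //.
  by apply: measurable_funM; [exact: measurable_coor|exact: continuous_measurable_rV].
by move=> z uz; rewrite normrM (le_trans _ (fM uz))// ler_piMl// uball_coord_le1.
Qed.

Let gi : (lebesgue_rV n).-integrable uball (EFin \o g).
Proof.
have mu' := @measurable_uball R n.
have h := RintegrableD mu' i1 (RintegrableZ mu' (- (2 * (b + 1))) i2).
by apply: Rintegrable_eq h => // z _; rewrite /g mulNr.
Qed.

Let G (z : 'rV[R]_n) : R := if sqn z < 1 then g z else 0.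

Let GE : (fun z => (G z)%:E) = (EFin \o g) \_ uball.
Proof.
apply/funext => z; rewrite /G patchE; case: ifPn => zu; first by rewrite mem_set.
by rewrite memNset// /uball/=; exact/negP.
Qed.

Let lineE (z : 'rV[R]_n) (s : R) :
  sqn (z + s *: basis_vector i) = (sqn z - z ord0 i ^+ 2) + (z ord0 i + s) ^+ 2.
Proof.
rewrite /sqn (bigD1 i)//= [in RHS](bigD1 i)//= !mxE !eqxx/= mulr1.
rewrite (eq_bigr (fun j => z ord0 j ^+ 2)); last first.
  by move=> j ji; rewrite !mxE (negbTE ji) andbF mulr0 addr0.
by rewrite [X in _ = X - _ + _]addrC addrK addrC.
Qed.

Let coordE (z : 'rV[R]_n) (s : R) : (z + s *: basis_vector i) ord0 i = z ord0 i + s.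
Proof. by rewrite !mxE !eqxx/= mulr1. Qed.

Let cline (h : 'rV[R]_n -> R) z (s : R) : continuous h ->
  {for s, continuous (fun s : R => h (z + s *: basis_vector i))}.
Proof.
move=> ch; apply: continuous_comp; last exact: ch.
by apply: cvgD; [exact: cvg_cst|apply: cvgZr_tmp; exact: cvg_id].
Qed.

(** On a chord of the ball, [g] is the derivative of [(1 - |z|^2)^(b+1) f],
    which vanishes at both ends. *)
Let slice0 z :
  mu.-integrable setT (EFin \o (fun s => G (z + s *: basis_vector i))) ->
  (\int[mu]_s (G (z + s *: basis_vector i))%:E = 0)%E.
Proof.
move=> Gi.
set c := z ord0 i; set rho := sqn z - c ^+ 2.
have [r1|r1] := leP 1 rho.
  rewrite integral0_eq// => s _; rewrite /G lineE -/c -/rho ltNge.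
  by rewrite (le_trans r1)//= lerDl sqr_ge0.
(* The line meets the ball in the chord [- c - w < s < - c + w]. *)
set w := Num.sqrt (1 - rho).
have w0 : 0 < w by rewrite sqrtr_gt0 subr_gt0.
have w2 : w ^+ 2 = 1 - rho by rewrite sqr_sqrtr// subr_ge0 ltW.
have inE s : (sqn (z + s *: basis_vector i) < 1) = (s \in `](- c - w), (- c + w)[).
  rewrite lineE -/c -/rho -ltrBrDl -w2 in_itv/=.
  rewrite -[in LHS](real_normK (num_real (c + s))) ltr_pXn2r ?nnegrE ?(ltW w0)//.
  by rewrite ltr_norml; apply/andP/andP => -[? ?]; split; lra.
pose y s := z + s *: basis_vector i.
have sy s : sqn (y s) = rho + (c + s) ^+ 2 by rewrite lineE.
have lt1 s : - c - w < s < - c + w -> 0 < 1 - sqn (y s).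
  by move=> si; rewrite subr_gt0 inE in_itv.
have dq (s : R) : is_derive s 1 (fun s => 1 - sqn (y s)) (- (2 * (c + s))).
  have h1 : is_derive s 1 (fun s : R => c + s) 1.
    by apply: is_derive_eq (is_deriveD (is_derive_cst c s 1) (is_derive_id s 1)) _; rewrite add0r.
  have h2 := is_deriveX 2 h1.
  have h3 := is_deriveB (is_derive_cst (1 - rho) s 1) h2.
  rewrite (_ : (fun s => 1 - sqn (y s)) = cst (1 - rho) - (fun s : R => c + s) ^+ 2); last first.
    by apply/funext => r; rewrite sy opprD addrA /GRing.exp/=.
  by apply: (is_derive_eq h3); rewrite sub0r /GRing.scale/= expr1 mulr1.
have cq (s : R) : {for s, continuous (fun s => 1 - sqn (y s))}.
  exact: is_derive_continuous (dq s).
have dpow p (s : R) : - c - w < s < - c + w ->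
    is_derive s 1 (fun s => (1 - sqn (y s)) `^ p) (p * (1 - sqn (y s)) `^ (p - 1) * - (2 * (c + s))).
  by move=> /lt1 s1; exact: (@is_derive1_comp R (fun a => a `^ p) (fun s => 1 - sqn (y s)) s _ _ (is_derive1_powR p s1) (dq s)).
have cpow p (s : R) : - c - w < s < - c + w -> {for s, continuous (fun s => (1 - sqn (y s)) `^ p)}.
  by move=> /(dpow p); exact: is_derive_continuous.
have dfl (s : R) : is_derive s 1 (fun s => f (y s)) (f' (y s)) by exact: is_derive_line.
have cc (s : R) : {for s, continuous (fun s => (y s) ord0 i)}.
  rewrite (_ : (fun s => _) = (fun s => c + s)); last by apply/funext => r; exact: coordE.
  by apply: cvgD; [exact: cvg_cst|exact: cvg_id].
have I_E : (\int[mu]_s (G (y s))%:E = \int[mu]_(s in `](- c - w)%R, (- c + w)%R[) (g (y s))%:E)%E.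
  rewrite [RHS](@integral_if _ _ _ mu _ (fun s : R => s \in `](- c - w), (- c + w)[))//.
  by apply: eq_integral => s _; rewrite /G inE; case: ifP.
have gyi : mu.-integrable `](- c - w)%R, (- c + w)%R[ (EFin \o (g \o y)).
  have h : mu.-integrable `](- c - w)%R, (- c + w)%R[ (EFin \o (fun s => G (y s))).
    exact: (integrableS measurableT _ _ Gi).
  apply: eq_integrable h => // s /set_mem /= si.
  by rewrite /G inE si.
rewrite I_E.
have fin : (\int[mu]_(s in `](- c - w)%R, (- c + w)%R[) (g (y s))%:E)%E \is a fin_num.
  exact: (integrable_fin_num _ gyi).
rewrite -(fineK fin); congr EFin.
rewrite -[RHS](subrr 0).
have ww : - c - w < - c + w by lra.
have cvg0 (F : set_system R) : Filter F -> (1 - sqn (y s)) @[s --> F] --> 0 ->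
   (\forall s \near F, - c - w < s < - c + w) ->
   (1 - sqn (y s)) `^ (b + 1) * f (y s) @[s --> F] --> 0.
  move=> FF F0 Fn; apply/norm_cvg0P.
  have h : (1 - sqn (y s)) `^ (b + 1) * M @[s --> F] --> 0 * M.
    apply: cvgMl.
    have c1 : (1 - sqn (y s)) @[s --> F] --> 0^'+.
      move=> A A0; have FA : F (fun s => 0 < 1 - sqn (y s) -> A (1 - sqn (y s))) := F0 _ A0.
      change (F (fun s => A (1 - sqn (y s)))).
      by apply: filterS2 FA Fn => s h /lt1.
    exact: (@cvg_comp _ _ _ (fun s => 1 - sqn (y s)) (fun a => a `^ (b + 1)) _ _ _ c1 (powR_cvg0 b1)).
  rewrite mul0r in h; apply: squeeze_cvgr (cvg_cst 0) h; near=> s.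
  rewrite normr_ge0/= normrM ger0_norm ?powR_ge0// ler_wpM2l ?powR_ge0// fM//.
  by rewrite /uball/= -subr_gt0; apply: lt1; near: s.
apply: (@FTC_oo R (g \o y) (fun s => (1 - sqn (y s)) `^ (b + 1) * f (y s)) _ _ 0 0 ww) => //.
- move=> s si; rewrite /g /bweight.
  apply: continuousB.
    by apply: continuousM; [exact: cpow|exact: cline].
  apply: continuousM; first exact: cst_continuous.
  apply: continuousM; first exact: cpow.
  by apply: continuousM; [exact: cc|exact: cline].
- move=> s si; apply: is_derive_eq (is_deriveM (dpow (b + 1) s si) (dfl s)) _.
  by rewrite /g /bweight /GRing.scale/= addrK -[y s]/(z + s *: basis_vector i) coordE -/c; ring.
- apply: cvg0.
  + rewrite (_ : 0 = 1 - sqn (y (- c - w))); last first.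
      by rewrite sy (_ : c + (- c - w) = - w) ?sqrrN ?w2; ring.
    by apply: cvg_at_right_filter; exact: cq.
  + by near=> s; apply/andP; split; near: s; [exact: nbhs_right_gt|exact: nbhs_right_lt].
- apply: cvg0.
  + rewrite (_ : 0 = 1 - sqn (y (- c + w))); last first.
      by rewrite sy (_ : c + (- c + w) = w) ?w2; ring.
    by apply: cvg_at_left_filter; exact: cq.
  + by near=> s; apply/andP; split; near: s; [exact: nbhs_left_gt|exact: nbhs_left_lt].
Unshelve. all: by end_near. Qed.

(** The derivative of [(1 - |z|^2)^(b+1)] along [z_i] is [- 2 (b + 1) z_i (1 -
    |z|^2)^b], and there is no boundary term because this power vanishes on the
    sphere. *)
Lemma ball_by_parts :
  2 * (b + 1) * \int[lebesgue_rV n]_(z in uball) (bweight b z * (z ord0 i * f z)) =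
  \int[lebesgue_rV n]_(z in uball) (bweight (b + 1) z * f' z).
Proof.
have mu' := @measurable_uball R n.
apply/esym/eqP; rewrite -subr_eq0 -RintegralZl//; apply/eqP.
rewrite -RintegralB//; last exact: (RintegrableZ mu' _ i2).
rewrite /Rintegral integral_mkcond -GE.
rewrite (@integral_slices0 R n i G)//.
  rewrite -[EFin \o G]/(fun z => (G z)%:E) GE.
  by rewrite -(integrable_mkcond _ mu'); exact: gi.
Qed.

End ball_by_parts_formula.

(** * Directional derivatives and bounded smooth functions *)

Section directional.
Context {R : realType}.

Lemma cvg_is_derive {V W : normedModType R} (f : V -> W) x v l :
  (fun h : R => h^-1 *: ((f \o shift x) (h *: v) - f x)) @ 0^' --> l ->
  is_derive x v f l.
Proof.
move=> h; apply: DeriveDef; first by apply/cvg_ex; exists l.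
exact: cvg_lim h.
Qed.

Lemma is_derive_cvg {V W : normedModType R} (f : V -> W) x v l :
  is_derive x v f l ->
  (fun h : R => h^-1 *: ((f \o shift x) (h *: v) - f x)) @ 0^' --> l.
Proof. by move=> [d <-]; exact: d. Qed.

Lemma is_derive_of_line {V W : normedModType R} (f : V -> W) (z v : V) (df : W) :
  is_derive (0 : R) 1 (fun r : R => f (z + r *: v)) df -> is_derive z v f df.
Proof.
by move=> [d1 d2]; apply: DeriveDef;
  [move: d1; rewrite derivable_line|rewrite -d2 derive_line];
  rewrite scale0r addr0.
Qed.

Lemma MVT0 (phi phi' : R -> R) : (forall r : R, is_derive r 1 phi (phi' r)) ->
  forall h, exists2 xi, `|xi| <= `|h| & phi h - phi 0 = phi' xi * h.
Proof.
move=> dphi h.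
have cphi (A : set R) : {within A, continuous phi}.
  by apply: continuous_subspaceT => r; exact: is_derive_continuous (dphi r).
have [h0|h0|->] := ltgtP h 0; last by exists 0 => //; rewrite subrr mulr0.
- have [c] := MVT h0 (fun x _ => dphi x) (cphi _).
  rewrite in_itv/= => /andP[hc c0] e; exists c.
    by rewrite !ltr0_norm// lerN2 ltW.
  by rewrite -opprB e sub0r mulrN opprK.
- have [c] := MVT h0 (fun x _ => dphi x) (cphi _).
  rewrite in_itv/= => /andP[c0 hc] e; exists c.
    by rewrite !gtr0_norm// ltW.
  by rewrite e subr0.
Qed.

(** The increment along [a] is taken at the point already moved along [b]; the
    mean value theorem and the continuity of the derivative along [a] absorb the
    move. *)
Lemma is_derive_addv {V : normedModType R} (f fa : V -> R) (x a b : V) (fb : R) :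
  (forall y, is_derive y a f (fa y)) -> {for x, continuous fa} ->
  is_derive x b f fb -> is_derive x (a + b) f (fa x + fb).
Proof.
move=> da ca /is_derive_cvg db; apply: cvg_is_derive.
rewrite (_ : (fun h => _) = (fun h : R => h^-1 *: (f (h *: a + (h *: b + x)) - f (h *: b + x)) +
    h^-1 *: ((f \o shift x) (h *: b) - f x))); last first.
  apply/funext => h /=; rewrite -scalerDr; congr (_ *: _).
  by rewrite [RHS]addrA subrK scalerDr -addrA.
apply: cvgD => //.
apply/cvgrPdist_le => e e0.
have /cvgrPdist_le/(_ _ e0) := ca; rewrite -nbhs_ballE => -[dlt /= dlt0 hb].
near=> h.
have h0 : h != 0 by near: h; exact: nbhs_dnbhs_neq.
have dphi (r : R) : is_derive r 1 (fun r : R => f ((h *: b + x) + r *: a)) (fa ((h *: b + x) + r *: a)).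
  by apply: is_derive_line; exact: da.
have [xi xih] := MVT0 dphi h.
rewrite scale0r addr0 [X in f X - _]addrC => ->.
rewrite -[_ *: _]/(_ * _) mulrCA mulVf// mulr1; apply: hb.
rewrite -ball_normE/= (_ : x - _ = - (h *: b + xi *: a)); last first.
  by rewrite addrAC opprD [LHS]addrC subrK.
rewrite normrN (le_lt_trans (ler_normD _ _))// !normrZ.
have ab0 : 0 < `|a| + `|b| + 1 by rewrite ltr_wpDl// addr_ge0.
apply: (@le_lt_trans _ _ (`|h| * (`|a| + `|b| + 1))).
  have : `|xi| * `|a| <= `|h| * `|a| by rewrite ler_wpM2r.
  by have : 0 <= `|h| by []; nra.
rewrite -ltr_pdivlMr//; near: h.
apply: dnbhs0_lt; exact: divr_gt0.
Unshelve. all: by end_near. Qed.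

Lemma is_derive_scalev {V : normedModType R} (f : V -> R) (x v : V) (c df : R) :
  is_derive x v f df -> is_derive x (c *: v) f (c * df).
Proof.
move=> d; apply: is_derive_of_line.
rewrite (_ : (fun r : R => f (x + r *: (c *: v))) = (fun r : R => f (x + r *: v)) \o (fun r : R => r * c)); last first.
  by apply/funext => r /=; rewrite scalerA.
rewrite mulrC; apply: is_derive1_comp.
  by rewrite mul0r; apply: is_derive_line; rewrite scale0r addr0.
apply: is_derive_eq (is_deriveM (is_derive_id (0 : R) 1) (is_derive_cst c (0:R) 1)) _.
by rewrite scaler0 add0r /GRing.scale/= mulr1.
Qed.

End directional.

Section smooth_bounded.
Context {R : realType} {n : nat}.
Implicit Types (f g : 'rV[R]_n -> R) (x v : 'rV[R]_n).

Definition rpartial (i : 'I_n) f : 'rV[R]_n -> R := fun x => 'D_(basis_vector i) f x.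

Definition iter_rpartial (s : seq 'I_n) f := foldr rpartial f s.

(** The class in which averages over balls are differentiated: boundedness of
    the derivatives dominates the integrands, continuity makes them measurable,
    and the class is stable under [rpartial] and [rlaplacian]. *)
Definition smooth_bounded f := forall s : seq 'I_n,
  [/\ continuous (iter_rpartial s f),
      forall i x, derivable (iter_rpartial s f) x (basis_vector i) &
      exists M, forall x, `|iter_rpartial s f x| <= M].

Definition rlaplacian f x : R := \sum_i rpartial i (rpartial i f) x.

Lemma smooth_bounded_continuous f : smooth_bounded f -> continuous f.
Proof. by move=> /(_ [::])[]. Qed.

Lemma smooth_bounded_bound f : smooth_bounded f -> exists M, forall x, `|f x| <= M.
Proof. by move=> /(_ [::])[]. Qed.

Lemma smooth_bounded_is_derive f i x : smooth_bounded f ->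
  is_derive x (basis_vector i) f (rpartial i f x).
Proof. by move=> /(_ [::])[_ /(_ i x) df _]; exact: DeriveDef. Qed.

Lemma smooth_bounded_rpartial f i : smooth_bounded f -> smooth_bounded (rpartial i f).
Proof.
move=> sf s; have := sf (rcons s i).
by rewrite /iter_rpartial foldr_rcons.
Qed.

Lemma smooth_bounded0 : smooth_bounded (fun=> 0).
Proof.
have e s : iter_rpartial s (fun=> 0) = fun=> 0.
  elim: s => //= i s ->; apply/funext => x; rewrite /rpartial.
  exact: derive_cst.
move=> s; rewrite e; split.
- by move=> x; exact: cst_continuous.
- by move=> i x; exact: derivable_cst.
- by exists 0 => x; rewrite normr0.
Qed.

Lemma smooth_boundedD f g : smooth_bounded f -> smooth_bounded g ->
  smooth_bounded (fun x => f x + g x).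
Proof.
move=> sf sg.
have e s : iter_rpartial s (fun x => f x + g x) = fun x => iter_rpartial s f x + iter_rpartial s g x.
  elim: s => //= i s ->; apply/funext => x; rewrite /rpartial.
  by apply: deriveD; [have [_ + _] := sf s|have [_ + _] := sg s]; exact.
move=> s; rewrite e; have [cf df [M fM]] := sf s; have [cg dg [N gN]] := sg s; split.
- by move=> x; apply: continuousD; [exact: cf|exact: cg].
- by move=> i x; apply: derivableD; [exact: df|exact: dg].
- by exists (M + N) => x; rewrite (le_trans (ler_normD _ _))// lerD.
Qed.

Lemma smooth_bounded_sum (I : Type) (s : seq I) (f : I -> 'rV[R]_n -> R) :
  (forall i, smooth_bounded (f i)) -> smooth_bounded (fun x => \sum_(i <- s) f i x).
Proof.
move=> sf; elim: s => [|i s ih].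
  rewrite (_ : (fun _ => _) = (fun=> 0)); first exact: smooth_bounded0.
  by apply/funext => x; rewrite big_nil.
rewrite (_ : (fun _ => _) = (fun x => f i x + \sum_(j <- s) f j x)); first exact: smooth_boundedD.
by apply/funext => x; rewrite big_cons.
Qed.

Lemma smooth_bounded_rlaplacian f : smooth_bounded f -> smooth_bounded (rlaplacian f).
Proof.
by move=> sf; apply: smooth_bounded_sum => i; do 2 apply: smooth_bounded_rpartial.
Qed.

(** Only derivatives along the axes are given; the other directions are reached
    by adding one coordinate at a time. *)
Lemma smooth_bounded_direction f x v : smooth_bounded f ->
  is_derive x v f (\sum_i v ord0 i * rpartial i f x).
Proof.
move=> sf; rewrite {1}[v]row_sum_delta.
elim: (index_enum _) => [|i s ih].
  rewrite !big_nil; apply: is_derive_of_line.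
  rewrite (_ : (fun _ => _) = cst (f x)); first exact: is_derive_cst.
  by apply/funext => r; rewrite scaler0 addr0.
rewrite !big_cons.
apply: (is_derive_addv (fa := fun y => v ord0 i * rpartial i f y)) => //.
- move=> y; apply: is_derive_scalev; exact: smooth_bounded_is_derive.
- apply: continuousM; first exact: cst_continuous.
  exact/smooth_bounded_continuous/smooth_bounded_rpartial.
Qed.

End smooth_bounded.

(** * Weighted averages over balls *)

Section ball_average.
Context {R : realType} {n : nat}.
Notation mu := (lebesgue_rV n).
Implicit Types (h : 'rV[R]_n -> R) (x : 'rV[R]_n) (t b : R).

Definition ball_average b h x t : R :=
  \int[mu]_(z in uball) (bweight b z * h (x + t *: z)).

Lemma measurable_affine_comp h x t : continuous h ->
  measurable_fun setT (fun z : 'rV[R]_n => h (x + t *: z)).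
Proof.
move=> ch; apply: (measurableT_comp (continuous_measurable_rV ch)).
exact: measurable_rV_affine.
Qed.

Lemma Rintegrable_average b h x t : 0 < b + 1 -> smooth_bounded h ->
  mu.-integrable uball (EFin \o (fun z => bweight b z * h (x + t *: z))).
Proof.
move=> b1 sh; have [M hM] := smooth_bounded_bound sh.
apply: (@Rintegrable_bweightM R n b b1 _ M) => //.
apply: measurable_affine_comp; exact: smooth_bounded_continuous.
Qed.

Lemma Rintegrable_coord_average b h x t i : 0 < b + 1 -> smooth_bounded h ->
  mu.-integrable uball (EFin \o (fun z => bweight b z * (z ord0 i * h (x + t *: z)))).
Proof.
move=> b1 sh; have [M hM] := smooth_bounded_bound sh.
apply: (@Rintegrable_bweightM R n b b1 _ M) => //.
  apply: measurable_funM; first exact: measurable_coor.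
  apply: measurable_affine_comp; exact: smooth_bounded_continuous.
by move=> z uz; rewrite normrM (le_trans _ (hM (x + t *: z)))// ler_piMl// uball_coord_le1.
Qed.

Section along.
Variables (b : R) (h : 'rV[R]_n -> R) (p v : 'rV[R]_n -> 'rV[R]_n).
Hypothesis b1 : 0 < b + 1.
Hypothesis sh : smooth_bounded h.
Hypothesis mp : measurable_fun setT p.
Hypothesis mv : measurable_fun setT v.
Hypothesis v1 : forall z i, uball z -> `|v z ord0 i| <= 1.

Let mline (f : 'rV[R]_n -> R) s : continuous f ->
  measurable_fun setT (fun z => f (p z + s *: v z)).
Proof.
move=> cf; apply: (measurableT_comp (continuous_measurable_rV cf)).
apply: measurable_fun_coorP => i.
rewrite (_ : (fun _ => _) = (fun z => p z ord0 i + s * v z ord0 i)); last first.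
  by apply/funext => z; rewrite !mxE.
by apply: measurable_funD; [|apply: measurable_funM => //];
   apply: (measurableT_comp (measurable_coor i)).
Qed.

(** One differentiation under the integral sign serves both variables: [p z = x
    + t z] with [v] a basis vector for [x], and [p z = x] with [v z = z] for
    [t]. *)
Lemma is_derive_average_along (s : R) :
  is_derive s 1 (fun s : R => \int[mu]_(z in uball) (bweight b z * h (p z + s *: v z)))
    (\sum_i \int[mu]_(z in uball) (bweight b z * (v z ord0 i * rpartial i h (p z + s *: v z)))).
Proof.
have mu' := @measurable_uball R n.
have [M hM] := smooth_bounded_bound sh.
have [N hN] : exists N : 'I_n -> R, forall i x, `|rpartial i h x| <= N i.
  have /choice[N hN] : forall i, exists N, forall x, `|rpartial i h x| <= N.
    by move=> i; exact/smooth_bounded_bound/smooth_bounded_rpartial.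
  by exists N.
pose k (r : R) (z : 'rV[R]_n) := bweight b z * h (p z + r *: v z).
pose G (z : 'rV[R]_n) := bweight b z * \sum_i N i.
have N0 i : 0 <= N i by exact: le_trans (hN i 0).
have G0 z : 0 <= G z by rewrite mulr_ge0 ?bweight_ge0// sumr_ge0.
have dk (r : R) z : is_derive r 1 (k^~ z)
    (bweight b z * \sum_i (v z ord0 i * rpartial i h (p z + r *: v z))).
  have h1 := is_derive_line (smooth_bounded_direction (p z + r *: v z) (v z) sh).
  exact: (is_deriveZ (bweight b z) h1).
have pk (r : R) z : partial1of2 k r z = bweight b z * \sum_i (v z ord0 i * rpartial i h (p z + r *: v z)).
  by rewrite partial1of2E; have [_] := dk r z.
have Is : `](s - 1), (s + 1)[%classic s by rewrite /= in_itv/=; lra.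
have ik (r : R) : `](s - 1), (s + 1)[%classic r -> mu.-integrable uball (EFin \o k r).
  move=> _; apply: (@Rintegrable_bweightM R n b b1 _ M) => //.
  apply: mline; exact: smooth_bounded_continuous.
have derk (r : R) z : `](s - 1), (s + 1)[%classic r -> uball z -> derivable (k^~ z) r 1.
  by move=> _ _; have [] := dk r z.
have iG : mu.-integrable uball (EFin \o G).
  have h1 := RintegrableZ mu' (\sum_i N i) (integrable_bweight n b1).
  by apply: eq_integrable h1 => // z _; rewrite /G/= mulrC.
have Gub (r : R) z : `](s - 1), (s + 1)[%classic r -> uball z -> `|partial1of2 k r z| <= G z.
  move=> _ uz; rewrite pk normrM ger0_norm ?bweight_ge0// ler_wpM2l ?bweight_ge0//.
  rewrite (le_trans (ler_norm_sum _ _ _))//; apply: ler_sum => i _.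
  by rewrite normrM (le_trans _ (hN i (p z + r *: v z)))// ler_piMl// v1.
apply: DeriveDef.
  have hd := @derivable_under_integral R _ _ mu k _ mu' s _ _ Is ik derk _ G0 iG Gub.
  exact: hd.
rewrite -derive1E.
rewrite (@differentiation_under_integral R _ _ mu k _ mu' s _ _ Is ik derk _ G0 iG Gub).
rewrite -Rintegral_sum//; last first.
  move=> i; apply: (@Rintegrable_bweightM R n b b1 _ (N i)) => //.
    apply: measurable_funM; first exact: (measurableT_comp (measurable_coor i)).
    apply: mline; exact/smooth_bounded_continuous/smooth_bounded_rpartial.
  by move=> z uz; rewrite normrM (le_trans _ (hN i (p z + s *: v z)))// ler_piMl// v1.
by apply: eq_Rintegral => z _; rewrite pk mulr_sumr.
Qed.

End along.

Lemma is_derive_average_x b h x t i : 0 < b + 1 -> smooth_bounded h ->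
  is_derive x (basis_vector i) (fun x => ball_average b h x t) (ball_average b (rpartial i h) x t).
Proof.
move=> b1 sh; apply: is_derive_of_line.
have v1 (z : 'rV[R]_n) j : uball z -> `|(basis_vector i : 'rV[R]_n) ord0 j| <= 1.
  by rewrite mxE eqxx/=; case: eqP => _ _; rewrite ?normr1 ?normr0.
have h1 := is_derive_average_along b1 sh (measurable_rV_affine x t)
  (measurable_cst (basis_vector i : 'rV[R]_n)) v1 0.
rewrite (_ : (fun _ => _) = (fun s => \int[mu]_(z in uball)
    (bweight b z * h (x + t *: z + s *: cst (basis_vector i) z)))); last first.
  by apply/funext => s; apply: eq_Rintegral => z _; rewrite addrAC.
apply: (is_derive_eq h1); rewrite (bigD1 i)//= big1 ?addr0.
  apply: eq_Rintegral => z _.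
  by rewrite scale0r addr0 mxE !eqxx mul1r.
move=> j ji; rewrite /Rintegral integral0_eq// => z _.
by rewrite mxE eqxx/= (negbTE ji) mul0r mulr0.
Qed.

Lemma is_derive_average_t0 b h x t : 0 < b + 1 -> smooth_bounded h ->
  is_derive t 1 (ball_average b h x)
   (\sum_i \int[mu]_(z in uball) (bweight b z * (z ord0 i * rpartial i h (x + t *: z)))).
Proof.
move=> b1 sh.
have v1 (z : 'rV[R]_n) j : uball z -> `|idfun z ord0 j| <= 1 by exact: uball_coord_le1.
exact: (is_derive_average_along b1 sh (measurable_cst x) (@measurable_id _ _ setT) v1 t).
Qed.

Lemma is_derive_affine h x t z i df : is_derive (x + t *: z) (basis_vector i) h df ->
  is_derive z (basis_vector i) (fun z => h (x + t *: z)) (t * df).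
Proof.
move=> dh; apply: is_derive_of_line.
rewrite (_ : (fun r : R => _) = (fun r : R => h ((x + t *: z) + r *: (t *: basis_vector i)))); last first.
  by apply/funext => r; rewrite scalerDr addrA !scalerA mulrC.
by apply: is_derive_line; rewrite scale0r addr0; exact: is_derive_scalev.
Qed.

Lemma continuous_affine_comp h x t : continuous h ->
  continuous (fun z : 'rV[R]_n => h (x + t *: z)).
Proof.
move=> ch z; apply: continuous_comp; last exact: ch.
by apply: continuousD; [exact: cst_continuous|exact: scaler_continuous].
Qed.

(** The factors [z_i] produced by the differentiation in [t] are removed by an
    integration by parts, which raises the exponent and turns the gradient into
    the Laplacian. *)
Lemma is_derive_average_t b h x t : 0 < b + 1 -> smooth_bounded h ->
  is_derive t 1 (ball_average b h x)
    (t / (2 * (b + 1)) * ball_average (b + 1) (rlaplacian h) x t).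
Proof.
move=> b1 sh; apply: (is_derive_eq (is_derive_average_t0 x t b1 sh)).
have c0 : 2 * (b + 1) != 0 by rewrite mulf_neq0// gt_eqF.
apply: (mulfI c0); rewrite mulrA mulrCA divff// mulr1.
have b2 : 0 < b + 1 + 1 by rewrite addr_gt0.
rewrite /ball_average mulr_sumr.
transitivity (\sum_i t * \int[mu]_(z in uball) (bweight (b + 1) z * rpartial i (rpartial i h) (x + t *: z))).
  apply: eq_bigr => i _.
  have si := smooth_bounded_rpartial i sh.
  have sii := smooth_bounded_rpartial i si.
  have [M hM] := smooth_bounded_bound si; have [N hN] := smooth_bounded_bound sii.
  have d3 z : is_derive z (basis_vector i) (fun z => rpartial i h (x + t *: z))
      (t * rpartial i (rpartial i h) (x + t *: z)).
    by apply: is_derive_affine; exact: smooth_bounded_is_derive.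
  rewrite (@ball_by_parts R n b b1 i (fun z => rpartial i h (x + t *: z))
     (fun z => t * rpartial i (rpartial i h) (x + t *: z)) (Num.max M (`|t| * N)) d3).
  - rewrite -RintegralZl//; last exact: Rintegrable_average.
      by apply: eq_Rintegral => z _; rewrite mulrCA.
    exact: measurable_uball.
  - apply: continuous_affine_comp; exact: smooth_bounded_continuous.
  - apply: continuous_mulr; first by move=> z; exact: cst_continuous.
    apply: continuous_affine_comp; exact: smooth_bounded_continuous.
  - by move=> z _; rewrite le_max hM.
  - by move=> z _; rewrite le_max normrM ler_wpM2l ?orbT.
rewrite -mulr_sumr; congr (_ * _); rewrite -Rintegral_sum.
- by apply: eq_Rintegral => z _; rewrite mulr_sumr.
- exact: measurable_uball.
- by move=> i; apply: Rintegrable_average => //; do 2 apply: smooth_bounded_rpartial.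
Qed.

(** Integrate by parts the divergence of [z h(x + t z)], that is [n h + t z .
    grad h], against the weight of exponent [b + 1]: this brings in [|z|^2 (1 -
    |z|^2)^b], the difference of the two weights. *)
Lemma is_derive_average_t_euler b h x t : 0 < b + 1 -> smooth_bounded h -> t != 0 ->
  is_derive t 1 (ball_average (b + 1) h x)
    (t^-1 * (2 * (b + 1) * ball_average b h x t - (2 * (b + 1) + n%:R) * ball_average (b + 1) h x t)).
Proof.
move=> b1 sh t0.
have b2 : 0 < b + 1 + 1 by rewrite addr_gt0.
have mu' := @measurable_uball R n.
apply: (is_derive_eq (is_derive_average_t0 x t b2 sh)).
apply: (mulfI t0); rewrite mulrA divff// mul1r.
have [M hM] := smooth_bounded_bound sh.
have M0 : 0 <= M by exact: le_trans (hM 0).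
pose S i := \int[mu]_(z in uball) (bweight (b + 1) z * (z ord0 i * rpartial i h (x + t *: z))).
pose Q i := \int[mu]_(z in uball) (bweight b z * (z ord0 i * (z ord0 i * h (x + t *: z)))).
have iQ i : mu.-integrable uball (EFin \o (fun z => bweight b z * (z ord0 i * (z ord0 i * h (x + t *: z))))).
  apply: (@Rintegrable_bweightM R n b b1 _ M) => //.
    do 2 (apply: measurable_funM; first exact: measurable_coor).
    apply: measurable_affine_comp; exact: smooth_bounded_continuous.
  move=> z uz; rewrite !normrM (le_trans _ (hM (x + t *: z)))//.
  by rewrite mulrA ler_piMl// mulr_ile1// uball_coord_le1.
have parts i : 2 * (b + 1) * Q i = ball_average (b + 1) h x t + t * S i.
  have si := smooth_bounded_rpartial i sh.
  have [N hN] := smooth_bounded_bound si.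
  have N0 : 0 <= N by exact: le_trans (hN 0).
  have d3 z : is_derive z (basis_vector i) (fun z : 'rV[R]_n => z ord0 i * h (x + t *: z))
      (h (x + t *: z) + z ord0 i * (t * rpartial i h (x + t *: z))).
    have d1 : is_derive z (basis_vector i) (fun z : 'rV[R]_n => z ord0 i) 1.
      apply: is_derive_of_line.
      rewrite (_ : (fun r : R => _) = cst (z ord0 i) + id); last first.
        by apply/funext => r; rewrite !mxE !eqxx/= mulr1.
      by apply: is_derive_eq (is_deriveD (is_derive_cst _ _ _) (is_derive_id _ _)) _; rewrite add0r.
    have d2 := is_derive_affine (smooth_bounded_is_derive i (x + t *: z) sh).
    by apply: is_derive_eq (is_deriveM d1 d2) _; rewrite /GRing.scale/=; ring.
  rewrite (@ball_by_parts R n b b1 i (fun z => z ord0 i * h (x + t *: z))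
     (fun z => h (x + t *: z) + z ord0 i * (t * rpartial i h (x + t *: z))) (M + `|t| * N) d3).
  - rewrite /ball_average /S -RintegralZl//; last exact: Rintegrable_coord_average.
    rewrite -RintegralD//; last 2 first.
      exact: Rintegrable_average.
      by apply: RintegrableZ => //; exact: Rintegrable_coord_average.
    by apply: eq_Rintegral => z _; ring.
  - apply: continuous_mulr; first exact: coord_continuous.
    apply: continuous_affine_comp; exact: smooth_bounded_continuous.
  - apply: continuous_addr; first by apply: continuous_affine_comp; exact: smooth_bounded_continuous.
    apply: continuous_mulr; first exact: coord_continuous.
    apply: continuous_mulr; first by move=> z; exact: cst_continuous.
    apply: continuous_affine_comp; exact: smooth_bounded_continuous.
  - move=> z uz; rewrite normrM (@le_trans _ _ M)//; last by rewrite lerDl mulr_ge0.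
    by rewrite (le_trans _ (hM (x + t *: z)))// ler_piMl// uball_coord_le1.
  - move=> z uz; rewrite (le_trans (ler_normD _ _))// lerD// !normrM.
    rewrite -[leRHS]mul1r ler_pM// ?mulr_ge0// ?uball_coord_le1//.
    by rewrite ler_pM.
(* [z_1^2 + ... + z_n^2] is [1 - (1 - |z|^2)], hence a difference of two
   weights. *)
have sumQ : \sum_i Q i = ball_average b h x t - ball_average (b + 1) h x t.
  rewrite /ball_average -RintegralB//; last 2 first.
    exact: Rintegrable_average.
    exact: Rintegrable_average.
  rewrite -Rintegral_sum//; apply: eq_Rintegral => z /set_mem uz.
  have q0 : 0 < 1 - sqn z by rewrite subr_gt0.
  have -> : bweight (b + 1) z = bweight b z * (1 - sqn z).
    by rewrite /bweight powRD ?powRr1 ?(ltW q0)// (gt_eqF q0) implybT.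
  rewrite -mulr_sumr -mulrA -mulrBr; congr (_ * _).
  rewrite mulrBl mul1r subKr /sqn mulr_suml.
  by apply: eq_bigr => i _; rewrite mulrA expr2.
transitivity (\sum_i (2 * (b + 1) * Q i - ball_average (b + 1) h x t)).
  by rewrite mulr_sumr; apply: eq_bigr => i _; rewrite parts [RHS]addrC addKr.
rewrite sumrB -mulr_sumr sumQ sumr_const card_ord -mulr_natl; ring.
Qed.

End ball_average.

(** * The solution for real data *)

Section wave.
Context {R : realType} {n : nat}.
Variables (s b : R).
Implicit Types (h : 'rV[R]_n -> R) (x : 'rV[R]_n) (t : R).
Hypothesis b1 : 0 < b + 1.
Hypothesis s0 : 0 < s.
(* The relation between the power of [t], the weight and the dimension for which
   the coefficients of [W[Delta h]] cancel in the derivatives of [wave]. *)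
Hypothesis snb : s + 4 = 2 * (b + 1) + n%:R.

Let c := 2 * (b + 1).
Let A h (x : 'rV[R]_n) t := ball_average b h x t.
Let W h (x : 'rV[R]_n) t := ball_average (b + 1) h x t.

(** The integral formula for real data, up to a constant factor, once its
    gradient term has been integrated by parts. *)
Definition wave (h : 'rV[R]_n -> R) (x : 'rV[R]_n) (t : R) : R :=
  t `^ s * ((s + 2) * ball_average b h x t + t ^+ 2 / (2 * (b + 1)) * ball_average (b + 1) (rlaplacian h) x t).

Let c0 : c != 0. Proof. by rewrite mulf_neq0// gt_eqF. Qed.
Let b2 : 0 < b + 1 + 1. Proof. by rewrite addr_gt0. Qed.

Let dsqr (t : R) : is_derive t 1 (fun t : R => t ^+ 2) (2 * t).
Proof.
apply: is_derive_eq (is_deriveX 2 (is_derive_id t 1)) _.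
by rewrite /GRing.scale/= expr1 mulr1.
Qed.

Definition wave_dt (h : 'rV[R]_n -> R) x t := s / t * wave h x t + t * t `^ s * ball_average b (rlaplacian h) x t.

(** The terms in [A[Delta h]] collected from the product rule have total
    coefficient [t^(s+1)], and those in [W[Delta h]] cancel by [snb], except for
    the [s / t] multiple of [wave]. *)
Lemma is_derive_wave h x t : smooth_bounded h -> 0 < t ->
  is_derive t 1 (wave h x) (wave_dt h x t).
Proof.
move=> sh t0; have sL := smooth_bounded_rlaplacian sh.
have t1 : t != 0 by rewrite gt_eqF.
have dA := is_derive_average_t x t b1 sh.
have dW := is_derive_average_t_euler x b1 sL t1.
have d1 := is_derive_mulr (is_derive_mulcr c^-1 (dsqr t)) dW.
have d2 := is_derive_mulr (is_derive_powR s t0) (is_derive_addr (is_derive_mulcr (s + 2) dA) d1).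
rewrite (_ : wave h x = (fun t => t `^ s * ((s + 2) * A h x t + c^-1 * t ^+ 2 * W (rlaplacian h) x t))); last first.
  by apply/funext => r; rewrite /wave -/c [_ / c]mulrC.
apply: (is_derive_eq d2).
rewrite /wave_dt /wave -/c -/(A h x t) -/(W (rlaplacian h) x t) -/(A (rlaplacian h) x t).
have -> : n%:R = s + 4 - c by rewrite snb -/c addrC addKr.
by field; rewrite t1 c0.
Qed.

(** Differentiating [t^(s+1) A[Delta h]] gives back the two terms of [wave
    (rlaplacian h)], up to a multiple of [t^s A[Delta h]] that the first
    derivative accounts for. *)
Lemma is_derive_wave_dt h x t : smooth_bounded h -> 0 < t ->
  is_derive t 1 (wave_dt h x) (wave (rlaplacian h) x t - (1 - s) / t * wave_dt h x t).
Proof.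
move=> sh t0; have sL := smooth_bounded_rlaplacian sh.
have t1 : t != 0 by rewrite gt_eqF.
have dV : is_derive t 1 (fun t : R => s * t^-1) (s * - t ^- 2).
  apply: is_derive_mulcr.
  apply: is_derive_eq (@is_deriveV R id t _ _ t1 (is_derive_id t 1)) _.
  by rewrite /GRing.scale/= mulr1.
have d1 := is_derive_mulr dV (is_derive_wave x sh t0).
have d2 := is_derive_mulr (is_derive_mulr (is_derive_id t 1) (is_derive_powR s t0)) (is_derive_average_t x t b1 sL).
apply: (is_derive_eq (is_derive_addr d1 d2)).
rewrite /wave_dt [wave (rlaplacian h) x t]/wave -/c -/(A (rlaplacian h) x t) -/(W (rlaplacian (rlaplacian h)) x t).
by rewrite /=; field; rewrite t1 c0.
Qed.

Lemma is_derive_wave_x h x t i : smooth_bounded h ->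
  is_derive x (basis_vector i) (fun x => wave h x t)
    (t `^ s * ((s + 2) * A (rpartial i h) x t + t ^+ 2 / c * W (rpartial i (rlaplacian h)) x t)).
Proof.
move=> sh; have sL := smooth_bounded_rlaplacian sh.
apply: is_derive_mulcr; apply: is_derive_addr; apply: is_derive_mulcr.
  exact: is_derive_average_x.
exact: is_derive_average_x.
Qed.

Lemma is_derive_wave_xx h x t i : smooth_bounded h ->
  is_derive x (basis_vector i) (rpartial i (fun x => wave h x t))
    (t `^ s * ((s + 2) * A (rpartial i (rpartial i h)) x t +
       t ^+ 2 / c * W (rpartial i (rpartial i (rlaplacian h))) x t)).
Proof.
move=> sh; have sL := smooth_bounded_rlaplacian sh.
have -> : rpartial i (fun x => wave h x t) = fun x =>
    t `^ s * ((s + 2) * A (rpartial i h) x t + t ^+ 2 / c * W (rpartial i (rlaplacian h)) x t).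
  by apply/funext => y; have [_] := is_derive_wave_x y t i sh.
apply: is_derive_mulcr; apply: is_derive_addr; apply: is_derive_mulcr.
  by apply: is_derive_average_x => //; exact: smooth_bounded_rpartial.
by apply: is_derive_average_x => //; exact: smooth_bounded_rpartial.
Qed.

Let average_rlaplacian p h x t : 0 < p + 1 -> smooth_bounded h ->
  \sum_i ball_average p (rpartial i (rpartial i h)) x t = ball_average p (rlaplacian h) x t.
Proof.
move=> p1 sh; rewrite /ball_average -Rintegral_sum.
- by apply: eq_Rintegral => z _; rewrite mulr_sumr.
- exact: measurable_uball.
- by move=> i; apply: Rintegrable_average => //; do 2 apply: smooth_bounded_rpartial.
Qed.

Lemma rlaplacian_wave h x t : smooth_bounded h ->
  rlaplacian (fun x => wave h x t) x = wave (rlaplacian h) x t.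
Proof.
move=> sh; have sL := smooth_bounded_rlaplacian sh.
rewrite {1}/rlaplacian (eq_bigr (fun i => t `^ s * ((s + 2) * A (rpartial i (rpartial i h)) x t +
  t ^+ 2 / c * W (rpartial i (rpartial i (rlaplacian h))) x t))); last first.
  by move=> i _; have [_] := is_derive_wave_xx x t i sh.
have lin (c1 c2 c3 : R) (F G : 'I_n -> R) :
    \sum_i c1 * (c2 * F i + c3 * G i) = c1 * (c2 * \sum_i F i + c3 * \sum_i G i).
  by rewrite [c2 * _]mulr_sumr [c3 * _]mulr_sumr -big_split mulr_sumr.
rewrite lin /wave -/c -(average_rlaplacian x t b1 sh) -(average_rlaplacian x t b2 sL).
by [].
Qed.

Let cvg_average p h x : 0 < p + 1 -> smooth_bounded h ->
  ball_average p h x t @[t --> 0^'+] --> ball_average p h x 0.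
Proof.
move=> p1 sh; apply: cvg_at_right_filter.
exact: is_derive_continuous (is_derive_average_t x 0 p1 sh).
Qed.

Lemma ball_average0 p h x : 0 < p + 1 ->
  ball_average p h x 0 = h x * \int[lebesgue_rV n]_(z in uball) bweight p z.
Proof.
move=> p1; rewrite /ball_average -RintegralZl.
- by apply: eq_Rintegral => z _; rewrite scale0r addr0 mulrC.
- exact: measurable_uball.
- exact: integrable_bweight.
Qed.

Let cvg_core h x : smooth_bounded h ->
  (s + 2) * ball_average b h x t + t ^+ 2 / c * ball_average (b + 1) (rlaplacian h) x t
    @[t --> 0^'+] --> (s + 2) * ball_average b h x 0.
Proof.
move=> sh; have sL := smooth_bounded_rlaplacian sh.
rewrite -[X in _ --> X]addr0; apply: cvgD.
  by apply: cvgM; [exact: cvg_cst|exact: cvg_average].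
rewrite -[X in _ --> X](mul0r (ball_average (b + 1) (rlaplacian h) x 0)).
apply: cvgM; last exact: cvg_average.
rewrite -[X in _ --> X](mul0r c^-1); apply: cvgMl.
rewrite -[X in _ --> X](expr0n _ 2); apply: cvg_at_right_filter.
exact: exprn_continuous.
Qed.

Lemma cvg_wave h x : smooth_bounded h -> wave h x t @[t --> 0^'+] --> 0.
Proof.
move=> sh; rewrite -[X in _ --> X](mul0r ((s + 2) * ball_average b h x 0)).
by apply: cvgM; [exact: powR_cvg0|exact: cvg_core].
Qed.

Lemma cvg_wave_dt h x : smooth_bounded h ->
  s^-1 * t `^ (1 - s) * wave_dt h x t @[t --> 0^'+] --> (s + 2) * ball_average b h x 0.
Proof.
move=> sh; have sL := smooth_bounded_rlaplacian sh.
have h1 : (s + 2) * ball_average b h x t + t ^+ 2 / c * ball_average (b + 1) (rlaplacian h) x t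
    + t ^+ 2 * s^-1 * ball_average b (rlaplacian h) x t
    @[t --> 0^'+] --> (s + 2) * ball_average b h x 0.
  rewrite -[X in _ --> X]addr0; apply: cvgD; first exact: cvg_core.
  rewrite -[X in _ --> X](mul0r (ball_average b (rlaplacian h) x 0)).
  apply: cvgM; last exact: cvg_average.
  rewrite -[X in _ --> X](mul0r s^-1); apply: cvgMl.
  rewrite -[X in _ --> X](expr0n _ 2); apply: cvg_at_right_filter.
  exact: exprn_continuous.
apply: cvg_trans h1; apply: near_eq_cvg; near=> t.
have t0 : 0 < t by near: t; exact: nbhs_right_gt.
have -> : t `^ (1 - s) = t / t `^ s.
  rewrite powRD; last by rewrite (gt_eqF t0) implybT.
  by rewrite powRr1 ?ltW// powRN.
rewrite /wave_dt /wave -/c.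
have p0 : t `^ s != 0 by rewrite gt_eqF ?powR_gt0.
by field; rewrite (gt_eqF t0) (gt_eqF s0) p0 c0.
Unshelve. all: by end_near. Qed.

End wave.

(** * The integral formula and its normalization *)

Section kirchhoff_integral.
Context {R : realType} {n : nat}.
Notation mu := (lebesgue_rV n).
Implicit Types (h : 'rV[R]_n -> R) (x y z : 'rV[R]_n) (t : R).

Lemma sqr_euclidean_norm z : euclidean_norm z ^+ 2 = sqn z.
Proof. by rewrite /euclidean_norm sqr_sqrtr// sqn_ge0. Qed.

Lemma euclidean_ballE x t y : 0 < t ->
  euclidean_ball x t y <-> sqn (x - y) < t ^+ 2.
Proof.
by move=> t0; rewrite /euclidean_ball/= -sqr_euclidean_norm ltr_pXn2r// nnegrE ?sqrtr_ge0// ltW.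
Qed.

Lemma sqn_affine x z t : sqn (x - (x + t *: z)) = t ^+ 2 * sqn z.
Proof. by rewrite opprD addNKr -scaleNr sqnZ sqrrN. Qed.

Lemma euclidean_ball_affine x t z : 0 < t -> euclidean_ball x t (x + t *: z) <-> uball z.
Proof.
move=> t0; rewrite euclidean_ballE// sqn_affine.
by rewrite gtr_pMr ?exprn_gt0.
Qed.

Lemma measurable_sqn_dist x : measurable_fun setT (fun y : 'rV[R]_n => sqn (x - y)).
Proof.
rewrite (_ : (fun _ => _) = (fun y => sqn (x + (-1) *: y))).
  exact: (measurableT_comp measurable_sqn (measurable_rV_affine x (-1))).
by apply/funext => y; rewrite scaleN1r.
Qed.

Lemma measurable_euclidean_ball x t : 0 < t -> measurable (euclidean_ball x t).
Proof.
move=> t0; rewrite (_ : euclidean_ball x t = (fun y => sqn (x - y)) @^-1` `]-oo, (t ^+ 2)[%classic).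
  by rewrite -[X in measurable X]setTI; apply: measurable_sqn_dist.
by apply/seteqP; split => y; rewrite /= in_itv/=; move/(euclidean_ballE _ _ t0).
Qed.

Section affine_ball.
Variables (x : 'rV[R]_n) (t : R) (f : 'rV[R]_n -> R).
Hypothesis t0 : 0 < t.
Hypothesis mf : measurable_fun setT f.
Hypothesis fi : mu.-integrable uball (EFin \o (fun z => f (x + t *: z))).

Let mB := measurable_euclidean_ball x t0.

Let patchE' z : (f \_ (euclidean_ball x t)) (x + t *: z) =
  ((fun z => f (x + t *: z)) \_ uball) z.
Proof.
rewrite !patchE; case: ifPn; case: ifPn => //.
  by rewrite notin_setE => nu /set_mem/(euclidean_ball_affine x z t0).
by move=> /set_mem/(euclidean_ball_affine x z t0) u; rewrite notin_setE.
Qed.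

Let mp : measurable_fun setT (f \_ (euclidean_ball x t)).
Proof. by apply/(measurable_restrictT f mB); exact: measurable_funTS. Qed.

Let ip : mu.-integrable setT (EFin \o (fun z => (f \_ (euclidean_ball x t)) (x + t *: z))).
Proof.
have := fi; rewrite (integrable_mkcond _ (@measurable_uball R n)).
apply: eq_integrable => // z _; rewrite /= patchE' !patchE.
by case: ifP.
Qed.

Lemma Rintegrable_ball_affine : mu.-integrable (euclidean_ball x t) (EFin \o f).
Proof.
have := Rintegrable_rV_affine t0 mp ip.
rewrite (integrable_mkcond _ mB); apply: eq_integrable => // z _.
by rewrite /= !patchE; case: ifP.
Qed.

Lemma Rintegral_ball_affine :
  \int[mu]_(y in euclidean_ball x t) f y = t ^+ n * \int[mu]_(z in uball) f (x + t *: z).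
Proof.
rewrite Rintegral_mkcond (Rintegral_rV_affine t0 mp ip) [in RHS]Rintegral_mkcond.
by congr (_ * _); apply: eq_Rintegral => z _; exact: patchE'.
Qed.

End affine_ball.

Variables (s b : R).
Hypothesis b1 : 0 < b + 1.
Hypothesis snb : s + 4 = 2 * (b + 1) + n%:R.

Definition kirchhoff_density h x t y : R :=
  (t ^+ 2 - euclidean_norm (x - y) ^+ 2) `^ b *
  ((s + 2) * h y + \sum_i (y - x) ord0 i * rpartial i h y).

Lemma measurable_kirchhoff_density h x t : smooth_bounded h ->
  measurable_fun setT (kirchhoff_density h x t).
Proof.
move=> sh; apply: measurable_funM.
  apply: (measurableT_comp (measurable_powR b)); apply: measurable_funB => //.
  under eq_fun do rewrite sqr_euclidean_norm.
  exact: measurable_sqn_dist.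
apply: measurable_funD.
  by apply: measurable_funM => //; apply: continuous_measurable_rV; exact: smooth_bounded_continuous.
apply: measurable_sum => i; apply: measurable_funM; last first.
  by apply: continuous_measurable_rV; exact/smooth_bounded_continuous/smooth_bounded_rpartial.
under eq_fun do rewrite !mxE.
by apply: measurable_funB => //; exact: measurable_coor.
Qed.

Lemma kirchhoff_density_affine h x t z : 0 < t -> uball z ->
  kirchhoff_density h x t (x + t *: z) =
  (t ^+ 2) `^ b * ((s + 2) * (bweight b z * h (x + t *: z)) +
     t * \sum_i (bweight b z * (z ord0 i * rpartial i h (x + t *: z)))).
Proof.
move=> t0 uz; rewrite /kirchhoff_density sqr_euclidean_norm sqn_affine.
rewrite -[X in X - _]mulr1 -mulrBr powRM ?exprn_ge0 ?(ltW t0)//; last first.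
  by rewrite subr_ge0 ltW.
rewrite -mulrA; congr (_ * _); rewrite mulrDr mulrCA; congr (_ + _).
rewrite !mulr_sumr; apply: eq_bigr => i _.
by rewrite !mxE addrAC subrr add0r /bweight; ring.
Qed.

Let integrable_terms h x t : smooth_bounded h ->
  mu.-integrable uball (EFin \o (fun z => \sum_i (bweight b z * (z ord0 i * rpartial i h (x + t *: z))))).
Proof.
move=> sh; apply: Rintegrable_sum; first exact: measurable_uball.
by move=> i; apply: Rintegrable_coord_average => //; exact: smooth_bounded_rpartial.
Qed.

Let integrable_core h x t : smooth_bounded h -> 0 < t ->
  mu.-integrable uball (EFin \o (fun z => kirchhoff_density h x t (x + t *: z))).
Proof.
move=> sh t0; have mU := @measurable_uball R n.
have h1 := RintegrableZ mU (s + 2) (Rintegrable_average x t b1 sh).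
have h2 := RintegrableZ mU t (integrable_terms x t sh).
have h3 := RintegrableZ mU ((t ^+ 2) `^ b) (RintegrableD mU h1 h2).
apply: eq_integrable h3 => // z /set_mem uz.
by rewrite /= kirchhoff_density_affine.
Qed.

Lemma integrable_kirchhoff_density h x t : smooth_bounded h -> 0 < t ->
  mu.-integrable (euclidean_ball x t) (EFin \o kirchhoff_density h x t).
Proof.
move=> sh t0; apply: Rintegrable_ball_affine => //.
  exact: measurable_kirchhoff_density.
exact: integrable_core.
Qed.

(** The scalings add up: [t^n] from the change of variables, [t^(2 b)] from the
    weight and [t^-2] make [t^s] because [s = 2 b + n - 2]. *)
Lemma kirchhoff_wave h x t : smooth_bounded h -> 0 < t ->
  (t ^+ 2)^-1 * \int[mu]_(y in euclidean_ball x t) kirchhoff_density h x t y =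
  wave s b h x t.
Proof.
move=> sh t0; have mU := @measurable_uball R n.
rewrite Rintegral_ball_affine//; last 2 first.
  exact: measurable_kirchhoff_density.
  exact: integrable_core.
have -> : \int[mu]_(z in uball) kirchhoff_density h x t (x + t *: z) =
    (t ^+ 2) `^ b * ((s + 2) * ball_average b h x t +
      t * (t / (2 * (b + 1)) * ball_average (b + 1) (rlaplacian h) x t)).
  have [_ e1] := is_derive_average_t0 x t b1 sh.
  have [_ e2] := is_derive_average_t x t b1 sh.
  rewrite -e2 e1 -Rintegral_sum//; last first.
    by move=> i; apply: Rintegrable_coord_average => //; exact: smooth_bounded_rpartial.
  have i1 := Rintegrable_average x t b1 sh.
  have i2 := integrable_terms x t sh.
  rewrite /ball_average -(RintegralZl (s + 2) mU i1) -(RintegralZl t mU i2).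
  rewrite -(RintegralD mU (RintegrableZ mU (s + 2) i1) (RintegrableZ mU t i2)).
  rewrite -(RintegralZl ((t ^+ 2) `^ b) mU (RintegrableD mU (RintegrableZ mU (s + 2) i1) (RintegrableZ mU t i2))).
  by apply: eq_Rintegral => z /set_mem uz; rewrite kirchhoff_density_affine.
have tp : (t ^+ 2)^-1 * (t ^+ n * (t ^+ 2) `^ b) = t `^ s.
  rewrite -!powR_mulrn ?(ltW t0)// -powRN -powRrM.
  rewrite -powRD; last by rewrite (gt_eqF t0) implybT.
  rewrite -powRD; last by rewrite (gt_eqF t0) implybT.
  by congr (_ `^ _); move: snb; lra.
rewrite /wave -tp; set P := _ `^ b.
by rewrite !(mulrA t) -expr2 !mulrA.
Qed.

End kirchhoff_integral.

(** Here [a] is [1/2 - sigma], [1 - sigma] or [3/2 - sigma] according to the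
    dimension, the last one being the reflection of [1/2 - (1 - sigma)]. *)
Lemma Gamma_sine_symmetric {R : realType} (d : nat) (sigma : R) :
  d \in [:: 3; 4; 5]%N -> 0 < sigma < 1 -> 1 < d%:R / 2 - sigma < 2 ->
  let a := d%:R / 2 - sigma - 1 in
  sin (a * pi) * (Gamma a * Gamma (1 - a)) =
  sin (sigma * pi) * (Gamma sigma * Gamma (1 - sigma)).
Proof.
have refl (x : R) : sin ((1 - x) * pi) * (Gamma (1 - x) * Gamma (1 - (1 - x))) =
    sin (x * pi) * (Gamma x * Gamma (1 - x)).
  by rewrite subKr mulrBl mul1r [pi - _]addrC sinDpi sinN opprK [Gamma x * _]mulrC.
rewrite !inE => /or3P[]/eqP-> /andP[s0 s1] /andP[d1 d2] /=.
- have -> : 3 / 2 - sigma - 1 = 2^-1 - sigma by field.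
  rewrite -Gamma_half_shift//; lra.
- have -> : 4 / 2 - sigma - 1 = 1 - sigma by field.
  exact: refl.
(* The symmetry [tau |-> 1 - tau], then [tau |-> 1/2 - tau] at [1 - sigma], then
   the first one again. *)
- have e : 5 / 2 - sigma - 1 = 1 - (2^-1 - (1 - sigma)) by field.
  rewrite e refl -Gamma_half_shift; [exact: refl|lra|lra].
Qed.

(** The integral of the weight contributes [Gamma (1 - a) / Gamma (sigma + 2)],
    whose denominator unfolds by the recurrence to [(sigma + 1) sigma Gamma
    sigma]; the quotient of the two sides of [Gamma_sine_symmetric] is left. *)
Lemma kirchhoff_constant {R : realType} (d : nat) (sigma : R) :
  d \in [:: 3; 4; 5]%N -> 0 < sigma < 1 -> 1 < d%:R / 2 - sigma < 2 ->
  let a := d%:R / 2 - sigma - 1 in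
  (sigma * sin (a * pi) * Gamma a)
    / (2 * pi `^ (d%:R / 2) * sin (sigma * pi) * Gamma (1 - sigma))
  * ((2 * sigma + 2) * \int[lebesgue_rV d]_(z in uball) bweight (- a) z) = 1.
Proof.
move=> d345 s01 a12 a.
have /andP[s0 s1] := s01; have /andP[d1 d2] := a12.
have refl := Gamma_sine_symmetric d345 s01 a12.
have b1 : 0 < - a + 1 by rewrite /a; lra.
have V := @integral_bweight R d (- a) b1.
have s2 : 0 < sigma + 1 by lra.
have t1 : 0 < 1 - sigma by lra.
have eg : - a + d%:R / 2 + 1 = sigma + 1 + 1 by rewrite /a; lra.
have G3 : Gamma (sigma + 1 + 1) = (sigma + 1) * (sigma * Gamma sigma).
  by rewrite (GammaS s2) (GammaS s0).
rewrite eg G3 in V.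
have G1 : 0 < Gamma sigma by exact: (Gamma_gt0 s0).
have G2 : 0 < Gamma (1 - sigma) by exact: (Gamma_gt0 t1).
have pd : pi `^ (d%:R / 2) = Num.sqrt pi ^+ d :> R.
  by rewrite -(powR12_sqrt (pi_ge0 R)) -(powR_mulrn d (powR_ge0 _ _)) -powRrM mulrC.
have pp : 0 < pi `^ (d%:R / 2) :> R by rewrite powR_gt0// pi_gt0.
have ss : 0 < sin (sigma * pi).
  by apply: sin_gt0_pi; rewrite mulr_gt0 ?pi_gt0//= gtr_pMl ?pi_gt0.
have -> : (\int[lebesgue_rV d]_(z in uball) bweight (- a) z) =
    pi `^ (d%:R / 2) * Gamma (1 - a) / ((sigma + 1) * (sigma * Gamma sigma)).
  have : (sigma + 1) * (sigma * Gamma sigma) != 0.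
    by rewrite (gt_eqF (mulr_gt0 s2 (mulr_gt0 s0 G1))).
  by rewrite pd (addrC 1) -V => /mulfK ->.
move: refl; rewrite -/a /=.
move: (Gamma (1 - a)) (Gamma a) (Gamma (1 - sigma)) (Gamma sigma) G1 G2 => g1 g2 g3 g4 G1 G2.
move: (sin (a * pi)) (sin (sigma * pi)) (pi `^ _) ss pp => S1 S2 P ss pp refl.
transitivity ((S1 * (g2 * g1)) / (S2 * (g4 * g3))).
  by field; rewrite !gt_eqF// addr_gt0.
by rewrite refl divff// gt_eqF// !mulr_gt0.
Qed.

(** * Complex data *)

Section complex_components.
Context {R : realType}.
Implicit Types (z w : Rcomplex R).

Lemma Rcomplex_eqP z w :
  z = w <-> complex.Re z = complex.Re w /\ complex.Im z = complex.Im w.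
Proof.
by split=> [->//|]; case: z w => [a b] [a' b'] /= [-> ->].
Qed.

Lemma Re_scale (a : R) z : complex.Re (a *: z) = a * complex.Re z.
Proof. by case: z. Qed.

Lemma Im_scale (a : R) z : complex.Im (a *: z) = a * complex.Im z.
Proof. by case: z. Qed.

Lemma normr_Re_le z : `|complex.Re z| <= `|z|.
Proof.
case: z => a b; change (`|a| <= Num.sqrt (a ^+ 2 + b ^+ 2)).
by rewrite -sqrtr_sqr ler_wsqrtr// lerDl sqr_ge0.
Qed.

Lemma normr_Im_le z : `|complex.Im z| <= `|z|.
Proof.
case: z => a b; change (`|b| <= Num.sqrt (a ^+ 2 + b ^+ 2)).
by rewrite -sqrtr_sqr ler_wsqrtr// lerDr sqr_ge0.
Qed.

Lemma Rcomplex_decomp z :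
  z = complex.Re z *: (1 : Rcomplex R) + complex.Im z *: (Complex 0 1 : Rcomplex R).
Proof.
case: z => a b; apply/Rcomplex_eqP; by split => /=; rewrite !mulr0 !mulr1 ?addr0 ?add0r.
Qed.

(** Each component is bounded by the modulus; conversely a complex number is the
    combination of [1] and [i] with its components as coefficients. *)
Lemma cvg_Rcomplex {T : Type} (F : set_system T) {FF : Filter F}
    (f : T -> Rcomplex R) z :
  f @ F --> z <->
  complex.Re (f x) @[x --> F] --> complex.Re z /\
  complex.Im (f x) @[x --> F] --> complex.Im z.
Proof.
split=> [/cvgrPdist_le fz|[fr fi]].
  split; apply/cvgrPdist_le => e e0; near=> x.
    rewrite -[X in `|X|](raddfB (@complex.Re R : Rcomplex R -> R)).
    by rewrite (le_trans (normr_Re_le _))//; near: x; exact: fz.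
  rewrite -[X in `|X|](raddfB (@complex.Im R : Rcomplex R -> R)).
  by rewrite (le_trans (normr_Im_le _))//; near: x; exact: fz.
rewrite (Rcomplex_decomp z) (_ : f = fun x => complex.Re (f x) *: (1 : Rcomplex R)
    + complex.Im (f x) *: (Complex 0 1 : Rcomplex R)); last first.
  by apply/funext => x; exact: Rcomplex_decomp.
by apply: cvgD; exact: cvgZr_tmp.
Unshelve. all: by end_near. Qed.

Lemma is_derive_Rcomplex {V : normedModType R} (f : V -> Rcomplex R) x v df :
  is_derive x v f df <->
  is_derive x v (fun y => complex.Re (f y)) (complex.Re df) /\
  is_derive x v (fun y => complex.Im (f y)) (complex.Im df).
Proof.
have er : (fun h : R => complex.Re (h^-1 *: ((f \o shift x) (h *: v) - f x))) =
    (fun h : R => h^-1 *: (((fun y => complex.Re (f y)) \o shift x) (h *: v) - complex.Re (f x))).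
  by apply/funext => h; rewrite Re_scale (raddfB (@complex.Re R : Rcomplex R -> R)).
have ei : (fun h : R => complex.Im (h^-1 *: ((f \o shift x) (h *: v) - f x))) =
    (fun h : R => h^-1 *: (((fun y => complex.Im (f y)) \o shift x) (h *: v) - complex.Im (f x))).
  by apply/funext => h; rewrite Im_scale (raddfB (@complex.Im R : Rcomplex R -> R)).
split=> [/is_derive_cvg/cvg_Rcomplex[]|[/is_derive_cvg hr /is_derive_cvg hi]].
  by rewrite er ei => hr hi; split; exact: cvg_is_derive.
by apply/cvg_is_derive/cvg_Rcomplex; rewrite er ei.
Qed.

End complex_components.

Section schwartz_components.
Context {R : realType} {n : nat}.
Implicit Types (g : 'rV[R]_n -> Rcomplex R).

Lemma smooth_is_derive g s i x : smooth g ->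
  is_derive x (basis_vector i) (iter_partial s g) (iter_partial (i :: s) g x).
Proof. by move=> /(_ s)[_ /(_ i x) d]; exact: DeriveDef. Qed.

Lemma iter_rpartial_component g s : smooth g ->
  iter_rpartial s (fun x => complex.Re (g x)) = (fun x => complex.Re (iter_partial s g x)) /\
  iter_rpartial s (fun x => complex.Im (g x)) = (fun x => complex.Im (iter_partial s g x)).
Proof.
move=> sg; elim: s => // i s [/= -> ->].
by split; apply/funext => x; rewrite /rpartial;
  have /is_derive_Rcomplex[[_ er] [_ ei]] := smooth_is_derive s i x sg.
Qed.

Lemma schwartz_bound g s : schwartz g ->
  exists M, forall x, `|iter_partial s g x| <= M.
Proof.
move=> [_ /(_ (fun=> 0) s)[M hM]]; exists M => x; have := hM x.
by rewrite /monomial big1 ?scale1r// => i _; rewrite expr0.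
Qed.

Lemma schwartz_component g : schwartz g ->
  smooth_bounded (fun x => complex.Re (g x)) /\ smooth_bounded (fun x => complex.Im (g x)).
Proof.
move=> sg; have [smg _] := sg.
split=> s; have [er ei] := iter_rpartial_component s smg; have [cg dg] := smg s;
  have [M hM] := schwartz_bound s sg; rewrite ?er ?ei; split.
- by move=> x; have /cvg_Rcomplex[] := cg x.
- by move=> i x; have /is_derive_Rcomplex[[]] := smooth_is_derive s i x smg.
- by exists M => x; rewrite (le_trans (normr_Re_le _)).
- by move=> x; have /cvg_Rcomplex[] := cg x.
- by move=> i x; have /is_derive_Rcomplex[_ []] := smooth_is_derive s i x smg.
- by exists M => x; rewrite (le_trans (normr_Im_le _)).
Qed.

End schwartz_components.

Section neumann_wave.
Context {R : realType} {n : nat}.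
Implicit Types (x : 'rV[R]_n) (t : R).
Variables (sigma b K : R) (g : 'rV[R]_n -> Rcomplex R).
Hypotheses (s0 : 0 < sigma) (b1 : 0 < b + 1).
Hypothesis snb : 2 * sigma + 4 = 2 * (b + 1) + n%:R.
Hypothesis sg : schwartz g.
Hypothesis normalized : K * ((2 * sigma + 2) * \int[lebesgue_rV n]_(z in uball) bweight b z) = 1.

Notation gr := (fun x => complex.Re (g x)).
Notation gi := (fun x => complex.Im (g x)).
Notation s := (2 * sigma).

Variable u : 'rV[R]_n -> R -> Rcomplex R.
Hypothesis uE : forall x t, 0 < t ->
  u x t = Complex (K * wave s b gr x t) (K * wave s b gi x t).

Let sgr : smooth_bounded gr. Proof. by have [] := schwartz_component sg. Qed.
Let sgi : smooth_bounded gi. Proof. by have [] := schwartz_component sg. Qed.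
Let ss0 : 0 < s. Proof. exact: mulr_gt0. Qed.

Let is_derive_u x t : 0 < t -> is_derive t 1 (u x)
  (Complex (K * wave_dt s b gr x t) (K * wave_dt s b gi x t)).
Proof.
move=> t0; apply: (@near_eq_is_derive _ _ _
  (fun r : R => Complex (K * wave s b gr x r) (K * wave s b gi x r) : Rcomplex R)).
  near=> r; rewrite uE//; near: r; exact: lt_nbhsr.
by apply/is_derive_Rcomplex; split; apply: is_derive_mulcr; exact: is_derive_wave.
Unshelve. all: by end_near. Qed.

Let derive1_u x t : 0 < t ->
  derive1 (u x) t = Complex (K * wave_dt s b gr x t) (K * wave_dt s b gi x t).
Proof. by move=> t0; rewrite derive1E; have [_] := is_derive_u x t0. Qed.

Let is_derive_u2 x t : 0 < t -> is_derive t 1 (derive1 (u x))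
  (Complex (K * (wave s b (rlaplacian gr) x t - (1 - s) / t * wave_dt s b gr x t))
           (K * (wave s b (rlaplacian gi) x t - (1 - s) / t * wave_dt s b gi x t))).
Proof.
move=> t0; apply: (@near_eq_is_derive _ _ _
  (fun r : R => Complex (K * wave_dt s b gr x r) (K * wave_dt s b gi x r) : Rcomplex R)).
  near=> r; rewrite derive1_u//; near: r; exact: lt_nbhsr.
by apply/is_derive_Rcomplex; split; apply: is_derive_mulcr; exact: is_derive_wave_dt.
Unshelve. all: by end_near. Qed.

Let is_derive_ux i x t : 0 < t -> is_derive x (basis_vector i) (u^~ t)
  (Complex (K * rpartial i (fun x => wave s b gr x t) x)
           (K * rpartial i (fun x => wave s b gi x t) x)).
Proof.
move=> t0; rewrite (_ : u^~ t = fun x => Complex (K * wave s b gr x t) (K * wave s b gi x t)); last first.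
  by apply/funext => y; exact: uE.
apply/is_derive_Rcomplex; split; apply: is_derive_mulcr; apply: DeriveDef => //.
  by have [] := is_derive_wave_x s b1 x t i sgr.
by have [] := is_derive_wave_x s b1 x t i sgi.
Qed.

Let is_derive_uxx i x t : 0 < t -> is_derive x (basis_vector i) (partial i (u^~ t))
  (Complex (K * rpartial i (rpartial i (fun x => wave s b gr x t)) x)
           (K * rpartial i (rpartial i (fun x => wave s b gi x t)) x)).
Proof.
move=> t0; rewrite (_ : partial i (u^~ t) = fun x =>
  Complex (K * rpartial i (fun x => wave s b gr x t) x)
          (K * rpartial i (fun x => wave s b gi x t) x)); last first.
  by apply/funext => y; have [_] := is_derive_ux i y t0.
apply/is_derive_Rcomplex; split; apply: is_derive_mulcr; apply: DeriveDef => //.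
  by have [] := is_derive_wave_xx s b1 x t i sgr.
by have [] := is_derive_wave_xx s b1 x t i sgi.
Qed.

Let laplacian_u x t : 0 < t -> laplacian (u^~ t) x =
  Complex (K * wave s b (rlaplacian gr) x t) (K * wave s b (rlaplacian gi) x t).
Proof.
move=> t0; have lin (D E : 'I_n -> R) :
    \sum_i (Complex (K * D i) (K * E i) : Rcomplex R) = Complex (K * \sum_i D i) (K * \sum_i E i).
  apply/Rcomplex_eqP; rewrite (raddf_sum (@complex.Re R : Rcomplex R -> R))
    (raddf_sum (@complex.Im R : Rcomplex R -> R)) /=.
  by split; rewrite mulr_sumr.
rewrite /laplacian (eq_bigr (fun i => (Complex
    (K * rpartial i (rpartial i (fun x => wave s b gr x t)) x)
    (K * rpartial i (rpartial i (fun x => wave s b gi x t)) x) : Rcomplex R))); last first.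
  by move=> i _; have [_] := is_derive_uxx i x t0.
apply: etrans (lin _ _) _.
have er := @rlaplacian_wave R n s b b1 _ x t sgr; have ei := @rlaplacian_wave R n s b b1 _ x t sgi.
exact: (congr2 (fun p q : R => Complex (K * p) (K * q)) er ei).
Qed.

Let near_gt0 : \forall t \near (0 : R)^'+, 0 < t.
Proof. exact: nbhs_right_gt. Qed.

(** It is enough that [u] agree with the real solutions for [t > 0], since the
    equation and the initial values only see positive times. *)
Lemma neumann_wave : neumann_solution sigma g u.
Proof.
split=> [x t t0|x|x].
- have [du _] := is_derive_u x t0; have [du2 e2] := is_derive_u2 x t0.
  split; first by split.
    by move=> i; split; [have [] := is_derive_ux i x t0|have [] := is_derive_uxx i x t0].
  have {}e2 : derive1n 2 (u x) t = _ := etrans (derive1E _ _) e2.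
  rewrite e2 (derive1_u x t0) (laplacian_u x t0); apply/Rcomplex_eqP.
  have lin (v w : R) : K * (w - (1 - s) / t * v) + (1 - s) / t * (K * v) = K * w by ring.
  by split; exact: lin.
- have lim h : smooth_bounded h -> K * wave s b h x t @[t --> 0^'+] --> 0.
    move=> sh; rewrite -[X in _ --> X](mulr0 K).
    by apply: cvgMl_tmp; exact: cvg_wave.
  apply/cvg_Rcomplex; split.
    apply: cvg_trans (lim _ sgr); apply: near_eq_cvg; near=> t.
    have t0 : 0 < t by near: t.
    by rewrite (uE x t0).
  apply: cvg_trans (lim _ sgi); apply: near_eq_cvg; near=> t.
  have t0 : 0 < t by near: t.
  by rewrite (uE x t0).
- have lim h : smooth_bounded h ->
      K * (s^-1 * t `^ (1 - s) * wave_dt s b h x t) @[t --> 0^'+] --> h x.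
    move=> sh; have -> : h x = K * ((s + 2) * ball_average b h x 0).
      by rewrite ball_average0// !(mulrCA _ (h x)) normalized mulr1.
    by apply: cvgMl_tmp; exact: cvg_wave_dt.
  apply/cvg_Rcomplex; split.
    apply: cvg_trans (lim _ sgr); apply: near_eq_cvg; near=> t.
    have t0 : 0 < t by near: t.
    by rewrite /sigma_dt (derive1_u x t0) Re_scale mulrCA.
  apply: cvg_trans (lim _ sgi); apply: near_eq_cvg; near=> t.
  have t0 : 0 < t by near: t.
  by rewrite /sigma_dt (derive1_u x t0) Im_scale mulrCA.
Unshelve. all: by end_near. Qed.

End neumann_wave.

Section kirchhoff_components.
Context {R : realType} {n : nat}.
Variables (sigma a : R) (g : 'rV[R]_n -> Rcomplex R).
Hypothesis sg : smooth g.

Let F x t y : Rcomplex R :=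
  ((t ^+ 2 - euclidean_norm (x - y) ^+ 2) `^ a)^-1
    *: ((2 * (sigma + 1)) *: g y + dot_gradient (y - x) g y).

Let partial_component i y :
  complex.Re (partial i g y) = rpartial i (fun x => complex.Re (g x)) y /\
  complex.Im (partial i g y) = rpartial i (fun x => complex.Im (g x)) y.
Proof.
have [er ei] := iter_rpartial_component [:: i] sg.
by split; [exact: esym (congr1 (@^~ y) er)|exact: esym (congr1 (@^~ y) ei)].
Qed.

Lemma kirchhoff_density_component x t y :
  complex.Re (F x t y) = kirchhoff_density (2 * sigma) (- a) (fun x => complex.Re (g x)) x t y /\
  complex.Im (F x t y) = kirchhoff_density (2 * sigma) (- a) (fun x => complex.Im (g x)) x t y.
Proof.
rewrite /F /kirchhoff_density powRN Re_scale Im_scale /dot_gradient.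
have e : 2 * (sigma + 1) = 2 * sigma + 2 by ring.
rewrite -e (raddfD (@complex.Re R : Rcomplex R -> R)) (raddfD (@complex.Im R : Rcomplex R -> R)).
rewrite (raddf_sum (@complex.Re R : Rcomplex R -> R)) (raddf_sum (@complex.Im R : Rcomplex R -> R)).
split; congr (_ * (_ + _)); [exact: Re_scale| |exact: Im_scale|];
  apply: eq_bigr => i _; have [er ei] := partial_component i y.
  by rewrite -er; exact: Re_scale.
by rewrite -ei; exact: Im_scale.
Qed.

End kirchhoff_components.

Theorem theorem3 (R : realType) (d : nat) (sigma : R)
    (g : 'rV[R]_d -> Rcomplex R) :
  d \in [:: 3; 4; 5]%N ->
  0 < sigma < 1 ->
  1 < d%:R / 2 - sigma < 2 ->
  schwartz g ->
  let C := (sigma * sin ((d%:R / 2 - sigma - 1) * pi)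
             * Gamma (d%:R / 2 - sigma - 1))
           / (2 * pi `^ (d%:R / 2) * sin (sigma * pi) * Gamma (1 - sigma)) in
  let F := fun (x : 'rV[R]_d) (t : R) (y : 'rV[R]_d) =>
    ((t ^+ 2 - euclidean_norm (x - y) ^+ 2) `^ (d%:R / 2 - sigma - 1))^-1
      *: ((2 * (sigma + 1)) *: g y + dot_gradient (y - x) g y) in
  let u := fun (x : 'rV[R]_d) (t : R) =>
    (C * (t ^+ 2)^-1)
      *: cintegral (lebesgue_rV d) (euclidean_ball x t) (F x t) in
  (forall x t, 0 < t ->
     cintegrable (lebesgue_rV d) (euclidean_ball x t) (F x t)) /\
  neumann_solution sigma g u.
Proof.
move=> d345 s01 a12 sg C F u.
have K1 : C * ((2 * sigma + 2) * \int[lebesgue_rV d]_(z in uball)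
    bweight (- (d%:R / 2 - sigma - 1)) z) = 1 := kirchhoff_constant d345 s01 a12.
have /andP[s0 s1] := s01; have /andP[d1 d2] := a12.
have [smg _] := sg; have [sgr sgi] := schwartz_component sg.
have b1 : 0 < - (d%:R / 2 - sigma - 1) + 1 by lra.
have snb : 2 * sigma + 4 = 2 * (- (d%:R / 2 - sigma - 1) + 1) + d%:R by field.
have FE := kirchhoff_density_component sigma (d%:R / 2 - sigma - 1) smg.
have FRe x t : (fun y => complex.Re (F x t y)) = kirchhoff_density (2 * sigma)
    (- (d%:R / 2 - sigma - 1)) (fun x => complex.Re (g x)) x t.
  by apply/funext => y; have [] := FE x t y.
have FIm x t : (fun y => complex.Im (F x t y)) = kirchhoff_density (2 * sigma)
    (- (d%:R / 2 - sigma - 1)) (fun x => complex.Im (g x)) x t.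
  by apply/funext => y; have [] := FE x t y.
split=> [x t t0|].
  split.
    have := integrable_kirchhoff_density (2 * sigma) b1 x sgr t0.
    by rewrite -FRe.
  have := integrable_kirchhoff_density (2 * sigma) b1 x sgi t0.
  by rewrite -FIm.
apply: (neumann_wave s0 b1 snb sg K1) => x t t0.
rewrite /u /cintegral FRe FIm; apply/Rcomplex_eqP; rewrite Re_scale Im_scale.
split; apply: etrans (esym (mulrA _ _ _)) _.
  exact: (congr1 ( *%R C) (kirchhoff_wave b1 snb x sgr t0)).
exact: (congr1 ( *%R C) (kirchhoff_wave b1 snb x sgi t0)).
Qed.
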